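(* Let $1\le p<\infty$, let $h\in H^p(\mathbb{D})$ and let $\psi:\mathbb{D}\to\mathbb{D}$ be holomorphic such that the weighted composition operator $W_{h,\psi}f(z)=h(z)f(\psi(z))$ is bounded on $H^p(\mathbb{D})$. For $w\in\mathbb{D}$ define $l_w(z)=\dfrac{(1-|w|^2)^{1/p}}{(1-\overline{w}z)^{2/p}}$ (so that $\|l_w\|_{H^p}=1$). Then $W_{h,\psi}$ is bounded below on $H^p$ (i.e. there is $\delta>0$ with $\|W_{h,\psi}f\|\ge\delta\|f\|$ for all $f\in H^p$) if and only if there is a constant $C>0$ such that $\|W_{h,\psi}l_w\|\ge C$ for all $w\in\mathbb{D}$.
   Context: $\mathbb{D}$ is the open unit disc and $H^p(\mathbb{D})$ the Hardy space; the power $(1-\overline w z)^{2/p}$ uses the principal branch (well defined since $\mathrm{Re}(1-\overline w z)>0$). *)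

(* Defs.v *)
From mathcomp Require Import all_boot all_order all_algebra.
From mathcomp Require Import all_classical all_reals all_analysis.
Import Order.TTheory GRing.Theory Num.Theory.
Import numFieldNormedType.Exports.
From mathcomp Require Export complex.

Set Implicit Arguments.
Unset Strict Implicit.
Unset Printing Implicit Defensive.

Local Open Scope ring_scope.
Local Open Scope complex_scope.

Section Hardy.
Variable R : realType.

Definition in_disc (z : R[i]) : Prop := ComplexField.Normc.normc z < 1.

(* f is holomorphic on D: complex differentiable at every point of D
   (derivative in the sense of the normed R[i]-module R[i]^o). *)
Definition holomorphic_on_disc (f : R[i] -> R[i]) : Prop :=
  forall z : R[i], in_disc z -> derivable (f : R[i]^o -> R[i]^o) z 1.

Definition polar (r t : R) : R[i] := r%:C * (cos t +i* sin t).

Definition hp_mean (p : R) (f : R[i] -> R[i]) (r : R) : \bar R :=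
  ((2 * pi)^-1)%:E *
  (\int[lebesgue_measure]_(t in `[0%R, (2 * pi)%R]%classic)
      ((ComplexField.Normc.normc (f (polar r t))) `^ p)%:E)%E.

Definition hp_sup (p : R) (f : R[i] -> R[i]) : \bar R :=
  ereal_sup [set hp_mean p f r | r in `]0, 1[%classic].

Definition in_Hp (p : R) (f : R[i] -> R[i]) : Prop :=
  holomorphic_on_disc f /\ (hp_sup p f < +oo)%E.

(* the H^p norm  ||f||_p = (sup_{0<r<1} M_p(f,r)^p)^{1/p} (meaningful for f in H^p) *)
Definition hp_norm (p : R) (f : R[i] -> R[i]) : R :=
  (fine (hp_sup p f)) `^ p^-1.

Definition wcomp (h psi : R[i] -> R[i]) (f : R[i] -> R[i]) : R[i] -> R[i] :=
  fun z => h z * f (psi z).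

(* principal branch of u^a for Re u > 0:
   u^a = exp(a Log u) = |u|^a (cos(a Arg u) + i sin(a Arg u)),
   with Arg u = atan(Im u / Re u) when Re u > 0. *)
Definition cpow_rhp (u : R[i]) (a : R) : R[i] :=
  ((ComplexField.Normc.normc u) `^ a)%:C *
  (cos (a * atan (Im u / Re u)) +i* sin (a * atan (Im u / Re u))).

Definition test_fn (p : R) (w : R[i]) : R[i] -> R[i] :=
  fun z => ((1 - ComplexField.Normc.normc w ^+ 2) `^ p^-1)%:C / cpow_rhp (1 - w^* * z) (2 / p).

End Hardy.

(* Main.v *)
(** Write [S f] for the p-th power of the [H^p] norm.  Holomorphic functions are only
    assumed complex differentiable, so everything starts from Goursat's lemma on
    rectangles; applied to [G (a + exp z)] it gives the mean value property, hence
    the subharmonicity of [|F|^q], and a maximum principle for finite averages of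
    rotations shows that the circle means of [|F|^q] increase with the radius.

    Lower bound from the test functions: [|l_w|^p] is the Poisson kernel
    [P_w z = (1 - |w|^2) / |1 - w^* z|^2].  If [F] is continuous on the closed disc,
    [g = |F|^p] satisfies [g w <= g z + e + K |w - z|^2], and [|w - z|^2 P_w z <= 1 - |w|^2]
    since [|w - z| <= |1 - w^* z|].  Averaging [c/2 <= mean |W l_w|^p] with weights [g w]
    over equidistributed points [w] of a circle of radius close to 1 thus bounds
    [(c/2) S F] by [2 S (W F)] up to [O(e)], because the average of [P_w z] over these [w]
    is at most 2.

    A general [F] is approximated by its dilates [F (d z)].  They converge to [F] in [H^p]:
    the defect [(|a|^p + |b|^p)/2 - (|a b|^(p/2) + |(a+b)/2|^p)/2] controls [|a - b|^p], and
    its circle means are small because those of the subtracted terms increase with the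
    radius.  As [W] is bounded, the estimate passes to the limit. *)
Require Import Defs.
From mathcomp Require Import all_boot all_order all_algebra.
From mathcomp Require Import all_classical all_reals all_analysis.
From mathcomp Require Import ring lra.
Import Order.TTheory GRing.Theory Num.Theory.
Import numFieldNormedType.Exports.
From mathcomp Require Import complex.

Set Implicit Arguments.
Unset Strict Implicit.
Unset Printing Implicit Defensive.

Local Open Scope ring_scope.
Local Open Scope complex_scope.
Local Open Scope classical_set_scope.

(** Three obstacles shape the proof. No boundary values are available: everything happens on circles
    of radius below 1, and monotone means stand in for boundary integrals. The constant [K] has to
    be fixed before the radius of the points [w] tends to 1, which requires uniform continuity of
    [g] on the closed disc; this is why dilates come in. The radius at which the mean of [|W l_w|^p]
    exceeds [c/2] depends on [w] without uniform control. Finitely many [w] share one radius, and a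
    finite sum commutes with the mean, so no double integral appears. For [p = 1] the midpoint term
    of the defect does not separate [a] from [b] on a common ray. The product term does: it compares
    the moduli. It is also the modulus of a holomorphic function, and its exponent [p/2], possibly
    below 1, is harmless because [|F|^q] is subharmonic for every [q > 0]. The losses ([c/2], the 2
    bounding the Poisson averages, [2^p] for a sum) only affect the size of [delta]. *)

Notation normc := ComplexField.Normc.normc.

(** * Topology of [R[i]^o] through real moduli *)

Section ComplexTopology.
Variable R : realType.
Local Notation C := (R[i]^o).
Implicit Types z w : C.

(* Canonical structure inference does not find this instance on [R[i]^o]. *)
#[global] Instance nbhsC_filter (z : C) : ProperFilter (nbhs z) :=
  nbhs_pfilter (z : C).

Lemma normc_norm (z : R[i]) : `|z| = (normc z)%:C.
Proof. by case: z. Qed.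

Lemma normc_ge0 (z : R[i]) : 0 <= normc z.
Proof. by case: z => a b; exact: sqrtr_ge0. Qed.

Lemma normcD (z w : R[i]) : normc (z + w) <= normc z + normc w.
Proof. exact: le_normcD. Qed.

Lemma normcB (z w : R[i]) : normc (z - w) = normc (w - z).
Proof. by rewrite -normcN opprB. Qed.

Lemma normc_real (x : R) : normc x%:C = `|x|.
Proof. by rewrite /= expr0n addr0 sqrtr_sqr. Qed.

Lemma normc_sqr (z : R[i]) : normc z ^+ 2 = Re z ^+ 2 + Im z ^+ 2.
Proof. by case: z => a b; rewrite /= sqr_sqrtr // addr_ge0 ?sqr_ge0. Qed.

Lemma ler_dist_normc (z w : R[i]) : `|normc z - normc w| <= normc (z - w).
Proof.
have h (u v : R[i]) : normc u <= normc (u - v) + normc v.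
  by have := normcD (u - v) v; rewrite subrK.
by rewrite ler_norml lerBlDr h andbT lerNl opprB lerBlDr normcB h.
Qed.

Lemma normc_Re (z : R[i]) : `|Re z| <= normc z.
Proof.
rewrite -(ler_pXn2r (n:=2)) ?nnegrE ?normc_ge0 //.
by rewrite normc_sqr real_normK ?num_real // lerDl sqr_ge0.
Qed.

Lemma normc_Im (z : R[i]) : `|Im z| <= normc z.
Proof.
rewrite -(ler_pXn2r (n:=2)) ?nnegrE ?normc_ge0 //.
by rewrite normc_sqr real_normK ?num_real // lerDr sqr_ge0.
Qed.

(** The norm of [R[i]^o] takes values in [R[i]], so its radii are positive complex numbers, that is,
    embedded reals. This lemma and [nbhsC_normcP] trade them for radii in [R]. *)
Lemma cvgC_normcP (T : Type) (F : set_system T) (FF : Filter F) (f : T -> C) (l : C) :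
  (f @ F --> l) <-> forall e : R, 0 < e -> \forall x \near F, normc (f x - l) < e.
Proof.
split=> [/cvgrPdist_lt fl e e0|fl].
  have e0' : 0 < e%:C by rewrite ltcR.
  by have := fl _ e0'; apply: filterS => x; rewrite distrC normc_norm ltcR.
apply/cvgrPdist_lt => e e0.
have [eR eE] : 0 < Re e /\ e = (Re e)%:C.
  by case: e e0 => a b; rewrite ltcE /= => /andP[/eqP -> ].
have := fl _ eR; apply: filterS => x.
by rewrite distrC normc_norm eE ltcR.
Qed.

Lemma cvgR_distP (T : Type) (F : set_system T) (FF : Filter F) (f : T -> R) (l : R) :
  (f @ F --> l) <-> forall e : R, 0 < e -> \forall x \near F, `|f x - l| < e.
Proof.
split=> [/cvgrPdist_lt fl e e0|fl].
  by have := fl _ e0; apply: filterS => x; rewrite distrC.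
apply/cvgrPdist_lt => e e0.
by have := fl _ e0; apply: filterS => x; rewrite distrC.
Qed.

Lemma nbhsC_normcP z (P : C -> Prop) :
  (\forall w \near z, P w) <-> exists2 d : R, 0 < d & forall w, normc (w - z) < d -> P w.
Proof.
split.
  move=> /nbhs_ballP[e /= e0 eP].
  have [eR eE] : 0 < Re e /\ e = (Re e)%:C.
    by case: e e0 {eP} => a b; rewrite ltcE /= => /andP[/eqP -> ].
  exists (Re e) => // w wz; apply: eP.
  by rewrite /ball /= distrC eE normc_norm ltcR.
move=> [d d0 dP]; apply/nbhs_ballP; exists d%:C; first by rewrite /= ltcR.
by move=> w; rewrite /ball /= distrC normc_norm ltcR => /dP.
Qed.

Lemma cvg_normc (T : Type) (F : set_system T) (FF : Filter F) (f : T -> C) (l : C) :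
  f @ F --> l -> normc (f x) @[x --> F] --> normc l.
Proof.
move=> /cvgC_normcP fl; apply/cvgR_distP => e e0.
have := fl _ e0; apply: filterS => x; apply: le_lt_trans; exact: ler_dist_normc.
Qed.

Lemma cvg_Re (T : Type) (F : set_system T) (FF : Filter F) (f : T -> C) (l : C) :
  f @ F --> l -> Re (f x) @[x --> F] --> Re l.
Proof.
move=> /cvgC_normcP fl; apply/cvgR_distP => e e0.
have := fl _ e0; apply: filterS => x; apply: le_lt_trans.
by rewrite -raddfB; exact: normc_Re.
Qed.

Lemma cvg_Im (T : Type) (F : set_system T) (FF : Filter F) (f : T -> C) (l : C) :
  f @ F --> l -> Im (f x) @[x --> F] --> Im l.
Proof.
move=> /cvgC_normcP fl; apply/cvgR_distP => e e0.
have := fl _ e0; apply: filterS => x; apply: le_lt_trans.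
by rewrite -raddfB; exact: normc_Im.
Qed.

Lemma cvg_real_complex (T : Type) (F : set_system T) (FF : Filter F) (f : T -> R) (l : R) :
  f @ F --> l -> ((f x)%:C : C) @[x --> F] --> (l%:C : C).
Proof.
move=> /cvgR_distP fl; apply/cvgC_normcP => e e0.
have := fl _ e0; apply: filterS => x.
by rewrite -raddfB normc_real.
Qed.

Lemma cvg_Complex (T : Type) (F : set_system T) (FF : Filter F) (f g : T -> R) (l m : R) :
  f @ F --> l -> g @ F --> m -> (f x +i* g x : C) @[x --> F] --> (l +i* m : C).
Proof.
move=> fl gm; rewrite (complexE (l +i* m)) /=.
under eq_fun => x do rewrite (complexE (f x +i* g x)) /=.
apply: cvgD; first exact: cvg_real_complex.
by apply: cvgM; [exact: cvg_cst|exact: cvg_real_complex].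
Qed.

(** The product [r%:C * cis t] is convertible to [polar r t], so the circle means of the statement
    are recovered without rewriting. *)
Definition cis (t : R) : C := cos t +i* sin t.

Lemma normc_cis t : normc (cis t) = 1.
Proof. by rewrite /= cos2Dsin2 sqrtr1. Qed.

Lemma cisD s t : cis (s + t) = cis s * cis t.
Proof. by rewrite /cis cosD sinD; congr Complex; rewrite addrC. Qed.

Lemma cis2pi t : cis (t + 2 * pi) = cis t.
Proof. by rewrite /cis mulr_natl cosD2pi sinD2pi. Qed.

Lemma continuous_cis : continuous cis.
Proof.
move=> t; apply: cvg_Complex; [exact: continuous_cos|exact: continuous_sin].
Qed.

Lemma derivableC_linear_approx (f : C -> C) z : derivable f z 1 ->
  forall e : R, 0 < e -> exists2 d : R, 0 < d & forall w, normc (w - z) < d ->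
  normc (f w - f z - 'D_1 f z * (w - z)) <= e * normc (w - z).
Proof.
move=> /[dup] df /cvgC_normcP; rewrite -/(derive f z 1) => H e e0.
have := H _ e0 => /nbhsC_normcP; rewrite /= => -[d d0 dP].
exists d => // w wz.
have [->|wnz] := eqVneq w z.
  by rewrite !subrr mulr0 subr0 ComplexField.Normc.normc0 mulr0.
have wz0 : w - z != 0 by rewrite subr_eq0.
have := dP (w - z); rewrite subr0 => /(_ wz wz0).
have -> : (w - z) *: (1 : C) + z = w by rewrite /GRing.scale /= mulr1 subrK.
move=> /ltW hh.
have -> : f w - f z - 'D_1 f z * (w - z) =
   ((w - z)^-1 *: (f w - f z) - 'D_1 f z) * (w - z).
  rewrite mulrBl; congr (_ - _); rewrite /GRing.scale /= mulrC mulrA mulfV //.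
  by rewrite mul1r.
by rewrite ComplexField.Normc.normcM ler_wpM2r // normc_ge0.
Qed.

Lemma derivableC_of_approx (f : C -> C) z (l : C) :
  (forall e : R, 0 < e -> exists2 d : R, 0 < d & forall w, normc (w - z) < d ->
  normc (f w - f z - l * (w - z)) <= e * normc (w - z)) -> derivable f z 1.
Proof.
move=> H; apply/cvg_ex; exists l; apply/cvgC_normcP => e e0.
have [d d0 dP] := H (e / 2) ltac:(by rewrite divr_gt0).
apply/nbhsC_normcP; exists d => // h; rewrite subr0 => hd hn0.
have := dP (h *: (1:C) + z); rewrite addrK /GRing.scale /= mulr1 => /(_ hd) hh.
have hn : 0 < normc h.
  rewrite lt_neqAle normc_ge0 andbT eq_sym; apply: contra hn0 => /eqP h0.
  by apply/eqP/ComplexField.Normc.eq0_normc.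
apply: (@le_lt_trans _ _ (e / 2)); last by rewrite ltr_pdivrMr // ltr_pMr // ltr1n.
have -> : h^-1 * (f (h + z) - f z) - l = h^-1 * (f (h + z) - f z - l * h).
  by rewrite [RHS]mulrBr; congr (_ - _); rewrite mulrCA mulVf // mulr1.
by rewrite ComplexField.Normc.normcM ComplexField.Normc.normcV mulrC ler_pdivrMr.
Qed.

End ComplexTopology.

Arguments ComplexField.Normc.normc : simpl never.

(** * Integrals of continuous functions over segments *)

Section SegmentIntegral.
Variable R : realType.
Local Notation mu := (@lebesgue_measure R).
Implicit Types (a b c : R) (f g : R -> R).

Definition segint a b f : R := \int[mu]_(x in `[a, b]) f x.

(** Continuity is two-sided even at the end points. This is more than continuity within the segment,
    but pointwise limit rules then apply without subspace topologies. *)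
Definition cont_seg a b f := forall x, a <= x <= b -> {for x, continuous f}.

Lemma cont_seg_within a b f : cont_seg a b f -> {within `[a, b], continuous f}.
Proof.
move=> cf; apply: continuous_in_subspaceT => x; rewrite inE /= in_itv /=.
exact: cf.
Qed.

Lemma cont_seg_integrable a b f :
  cont_seg a b f -> mu.-integrable `[a, b] (EFin \o f).
Proof.
move=> cf; apply: continuous_compact_integrable; first exact: segment_compact.
exact: cont_seg_within.
Qed.

Lemma cont_segM a b f g : cont_seg a b f -> cont_seg a b g ->
  cont_seg a b (fun x => f x * g x).
Proof. by move=> cf cg x xab; apply: cvgM; [exact: cf|exact: cg]. Qed.

Lemma cont_seg_cst a b (k : R) : cont_seg a b (fun=> k).
Proof. by move=> x xab; exact: cvg_cst. Qed.

Lemma cont_segT a b f : continuous f -> cont_seg a b f.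
Proof. by move=> cf x xab; exact: cf. Qed.

Lemma eq_segint a b f g : (forall x, a <= x <= b -> f x = g x) ->
  segint a b f = segint a b g.
Proof. by move=> fg; apply: eq_Rintegral => x; rewrite inE /= in_itv; exact: fg. Qed.

Lemma segintD a b f g : cont_seg a b f -> cont_seg a b g ->
  segint a b (fun x => f x + g x) = segint a b f + segint a b g.
Proof. by move=> cf cg; rewrite /segint RintegralD //; exact: cont_seg_integrable. Qed.

Lemma segintB a b f g : cont_seg a b f -> cont_seg a b g ->
  segint a b (fun x => f x - g x) = segint a b f - segint a b g.
Proof. by move=> cf cg; rewrite /segint RintegralB //; exact: cont_seg_integrable. Qed.

Lemma segintZ a b f k : cont_seg a b f ->
  segint a b (fun x => k * f x) = k * segint a b f.
Proof. by move=> cf; rewrite /segint RintegralZl //; exact: cont_seg_integrable. Qed.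

Lemma segint_cst a b k : a <= b -> segint a b (fun=> k) = k * (b - a).
Proof.
move=> ab.
have lab : fine (mu `[a, b]) = b - a.
  rewrite lebesgue_measure_itv /= lte_fin; case: ltP => //= ba.
  by apply/esym/eqP; rewrite subr_eq0 eq_le ab ba.
by rewrite /segint (Rintegral_cst mu) // lab.
Qed.

Lemma le_segint a b f g : cont_seg a b f -> cont_seg a b g ->
  (forall x, a <= x <= b -> f x <= g x) -> segint a b f <= segint a b g.
Proof.
move=> cf cg fg; apply: le_Rintegral; [by []|exact: cont_seg_integrable..|].
by move=> x /=; rewrite in_itv; exact: fg.
Qed.

Lemma segint_norm_le a b f k : a <= b -> cont_seg a b f ->
  (forall x, a <= x <= b -> `|f x| <= k) -> `|segint a b f| <= k * (b - a).
Proof.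
move=> ab cf fk; rewrite ler_norml -mulNr -!segint_cst //.
by apply/andP; split; apply: le_segint => //; try exact: cont_seg_cst;
  move=> x /fk; rewrite ler_norml => /andP[].
Qed.

Lemma segint_Chasles a b c f : a <= c -> c <= b -> cont_seg a b f ->
  segint a b f = segint a c f + segint c b f.
Proof.
move=> ac cb cf.
have iab := cont_seg_integrable cf.
rewrite /segint -(@Rintegral_itv_obnd_cbnd _ c); last first.
  by apply: integrableS iab => //; apply: subset_itvr; rewrite bnd_simp.
rewrite -(@Rintegral_itvB _ f (BLeft a) (BRight b) c) //; rewrite ?bnd_simp //.
by rewrite addrC subrK.
Qed.

Lemma segint_shift a b s f : a <= b -> continuous f ->
  segint a b (fun x => f (x + s)) = segint (a + s) (b + s) f.
Proof.
move=> ab cf.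
have dE : (fun x : R => x + s)^`() = cst 1.
  apply/funext => x; rewrite derive1E deriveD //.
  by rewrite derive_id derive_cst addr0.
have csh : continuous (fun x : R => x + s).
  by move=> x; apply: cvgD; [exact: cvg_id|exact: cvg_cst].
rewrite /segint /Rintegral; congr fine.
rewrite (@integration_by_substitution_increasing _ (fun x : R => x + s)) //.
- by apply: eq_integral => x _; rewrite dE /= mulr1.
- by move=> x y _ _; rewrite ltrD2r.
- by rewrite dE => x _; exact: cvg_cst.
- by rewrite dE; exact: is_cvg_cst.
- by rewrite dE; exact: is_cvg_cst.
- split; first by move=> x _; apply: derivableD.
  + exact: (cvg_at_right_filter (csh a)).
  + exact: (cvg_at_left_filter (csh b)).
- exact: continuous_subspaceT.
Qed.

Lemma segint_id a b : a <= b -> segint a b id = (b ^+ 2 - a ^+ 2) / 2.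
Proof.
rewrite le_eqVlt => /predU1P[<-|ab].
  by rewrite subrr mul0r /segint set_itv1 Rintegral_set1.
have dx (x : R) : is_derive x 1 (fun x : R => x ^+ 2 / 2) x.
  have -> : (fun x : R => x ^+ 2 / 2) = (fun x : R => 2^-1 *: x ^+ 2).
    by apply/funext => y; rewrite mulrC.
  have := is_deriveZ 2^-1 (is_deriveX 2 (is_derive_id x (1 : R))).
  rewrite /GRing.scale /= expr1 mulr1 mulrA mulVf ?pnatr_eq0 // mul1r.
  by have -> : 2^-1 \*: id ^+ 2 = (fun y : R => 2^-1 * y ^+ 2) by apply/funext.
rewrite /segint /Rintegral (@continuous_FTC2 _ id (fun x => x ^+ 2 / 2)) //=.
- by rewrite mulrBl.
- exact: (cont_seg_within (cont_segT (fun x => cvg_id))).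
- have cx (x : R) : {for x, continuous (fun x : R => x ^+ 2 / 2)}.
    by apply/differentiable_continuous/derivable1_diffP; have [] := dx x.
  split; first by move=> x _; have [] := dx x.
  + exact: (cvg_at_right_filter (cx a)).
  + exact: (cvg_at_left_filter (cx b)).
- by move=> x _; rewrite derive1E; have [_ ->] := dx x.
Qed.

Lemma segint_affine a b (k l : R) : a <= b ->
  segint a b (fun x => k + l * x) = k * (b - a) + l * ((b ^+ 2 - a ^+ 2) / 2).
Proof.
move=> ab.
have cid x : {for x, continuous (@idfun R)} by exact: cvg_id.
rewrite segintD; last 2 first.
- exact: cont_seg_cst.
- by apply: cont_segM => [|x _]; [exact: cont_seg_cst|exact: cid].
by rewrite segint_cst // segintZ ?segint_id // => x _; exact: cid.
Qed.

Lemma segint0 a f : segint a a f = 0.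
Proof. by rewrite /segint set_itv1 Rintegral_set1. Qed.

End SegmentIntegral.

(** * Goursat's lemma on rectangles *)

Section Goursat.
Variable R : realType.
Local Notation C := (R[i]^o).

Lemma exists_half_pow (K d : R) : 0 < d -> exists n : nat, K / 2 ^+ n < d.
Proof.
move=> d0; exists (Num.truncn (K / d)).+1.
rewrite ltr_pdivrMr ?exprn_gt0 // -ltr_pdivrMl // mulrC.
apply: (lt_trans (truncnS_gt _)).
by rewrite -natrX ltr_nat ltn_expl.
Qed.

(** If [P] failed, one quarter would fail at each halving, and the nested failing rectangles would
    shrink to a point, where the local hypothesis says that small rectangles are good. *)
Lemma rect_bisection (P : R -> R -> R -> R -> Prop) (x1 x2 y1 y2 : R) :
  x1 <= x2 -> y1 <= y2 ->
  (forall a b c e, x1 <= a -> a <= b -> b <= x2 -> y1 <= c -> c <= e -> e <= y2 ->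
    P a ((a + b) / 2) c ((c + e) / 2) -> P ((a + b) / 2) b c ((c + e) / 2) ->
    P a ((a + b) / 2) ((c + e) / 2) e -> P ((a + b) / 2) b ((c + e) / 2) e ->
    P a b c e) ->
  (forall x y, x1 <= x <= x2 -> y1 <= y <= y2 -> exists2 d : R, 0 < d &
     forall a b c e, x1 <= a -> a <= x <= b -> b <= x2 ->
       y1 <= c -> c <= y <= e -> e <= y2 -> b - a < d -> e - c < d -> P a b c e) ->
  P x1 x2 y1 y2.
Proof.
move=> x12 y12 Padd Ploc; apply: contrapT => nP.
pose w n : R := (x2 - x1) / 2 ^+ n; pose h n : R := (y2 - y1) / 2 ^+ n.
have w0 n : 0 <= w n by rewrite divr_ge0 ?exprn_ge0 // subr_ge0.
have h0 n : 0 <= h n by rewrite divr_ge0 ?exprn_ge0 // subr_ge0.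
have wS n : w n = w n.+1 + w n.+1.
  by rewrite /w exprS; field; rewrite expf_neq0 // pnatr_eq0.
have hS n : h n = h n.+1 + h n.+1.
  by rewrite /h exprS; field; rewrite expf_neq0 // pnatr_eq0.
(* Here [s] is the lower left corner of a rectangle of sides [w n] and [h n]. *)
pose bad n (s : R * R) := [/\ x1 <= s.1, s.1 + w n <= x2, y1 <= s.2, s.2 + h n <= y2
  & ~ P s.1 (s.1 + w n) s.2 (s.2 + h n)].
(* The implication is placed under the existential so that the choice of [s'] is a total function of
   [n] and [s]. *)
have step n s : exists s' : R * R, bad n s -> [/\ bad n.+1 s',
    s.1 <= s'.1, s'.1 + w n.+1 <= s.1 + w n, s.2 <= s'.2 & s'.2 + h n.+1 <= s.2 + h n].
  apply: contrapT => /forallNP ns.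
  have /not_implyP[bs _] := ns s; case: (bs) => X1 X2 Y1 Y2; apply.
  have good s' : s.1 <= s'.1 -> s'.1 + w n.+1 <= s.1 + w n ->
      s.2 <= s'.2 -> s'.2 + h n.+1 <= s.2 + h n ->
      P s'.1 (s'.1 + w n.+1) s'.2 (s'.2 + h n.+1).
    move=> A B D E; apply: contrapT => nPs; apply: (ns s') => _; split => //.
    by split => //; lra.
  have W := wS n; have H := hS n; have W0 := w0 n.+1; have H0 := h0 n.+1.
  have mw : (s.1 + (s.1 + w n)) / 2 = s.1 + w n.+1 by rewrite W; field.
  have mh : (s.2 + (s.2 + h n)) / 2 = s.2 + h n.+1 by rewrite H; field.
  apply: Padd; rewrite ?mw ?mh //; try lra.
  - by apply: good; lra.
  - by have := good (s.1 + w n.+1, s.2); rewrite /= -addrA -W; apply; lra.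
  - by have := good (s.1, s.2 + h n.+1); rewrite /= -addrA -H; apply; lra.
  - by have := good (s.1 + w n.+1, s.2 + h n.+1); rewrite /= -!addrA -W -H; apply; lra.
pose f n s := projT1 (cid (step n s)).
have fP n s : bad n s -> [/\ bad n.+1 (f n s),
    s.1 <= (f n s).1, (f n s).1 + w n.+1 <= s.1 + w n,
    s.2 <= (f n s).2 & (f n s).2 + h n.+1 <= s.2 + h n].
  exact: (projT2 (cid (step n s))).
pose u := fix u n := if n is m.+1 then f m (u m) else (x1, y1).
have ub n : bad n (u n).
  elim: n => [|n /fP[]//].
  rewrite /bad /= /w /h expr0 !divr1 !(addrC _ (_ - _)) !subrK.
  by split => //; exact: lexx.
have mono1 n k : (u n).1 <= (u (k + n)%N).1 /\ (u (k + n)%N).1 + w (k + n)%N <= (u n).1 + w n.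
  elim: k => [//|k [IH1 IH2]]; have [_ A B _ _] := fP _ _ (ub (k + n)%N).
  by rewrite addSn /=; split; lra.
have mono2 n k : (u n).2 <= (u (k + n)%N).2 /\ (u (k + n)%N).2 + h (k + n)%N <= (u n).2 + h n.
  elim: k => [//|k [IH1 IH2]]; have [_ _ _ A B] := fP _ _ (ub (k + n)%N).
  by rewrite addSn /=; split; lra.
have cross1 n m : (u n).1 <= (u m).1 + w m.
  have := (mono1 n m).1; have := (mono1 m n).2; rewrite addnC.
  by have := w0 (m + n)%N; lra.
have cross2 n m : (u n).2 <= (u m).2 + h m.
  have := (mono2 n m).1; have := (mono2 m n).2; rewrite addnC.
  by have := h0 (m + n)%N; lra.
(* By [cross1] and [cross2] every lower corner is below every upper one, so these suprema lie in all
   the rectangles. *)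
pose x := sup (range (fun n => (u n).1)); pose y := sup (range (fun n => (u n).2)).
have xP n : (u n).1 <= x <= (u n).1 + w n.
  apply/andP; split.
    by apply: ub_le_sup; [exists (x1 + w 0%N) => _ [m _ <-]; exact: (cross1 m 0%N)|exists n].
  by apply: ge_sup; [exists (u 0%N).1, 0%N|move=> _ [m _ <-]].
have yP n : (u n).2 <= y <= (u n).2 + h n.
  apply/andP; split.
    by apply: ub_le_sup; [exists (y1 + h 0%N) => _ [m _ <-]; exact: (cross2 m 0%N)|exists n].
  by apply: ge_sup; [exists (u 0%N).2, 0%N|move=> _ [m _ <-]].
have [d d0 dP] : exists2 d : R, 0 < d &
     forall a b c e, x1 <= a -> a <= x <= b -> b <= x2 ->
       y1 <= c -> c <= y <= e -> e <= y2 -> b - a < d -> e - c < d -> P a b c e.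
  apply: Ploc.
    by have := xP 0%N; have [] := ub 0%N; lra.
  by have := yP 0%N; have [] := ub 0%N; lra.
have [n nP'] := exists_half_pow ((x2 - x1) + (y2 - y1)) d0.
have wh : w n + h n < d by rewrite /w /h -mulrDl.
have := w0 n; have := h0 n => hn wn.
have [b1 b2 b3 b4] := ub n; apply; apply: dP => //; lra.
Qed.

Lemma derivableC_continuous (H : C -> C) z : derivable H z 1 -> {for z, continuous H}.
Proof. by move=> /derivable1_diffP/differentiable_continuous. Qed.

Lemma continuous_affine (k l : C) : continuous (fun w : C => k + l * w : C).
Proof.
move=> w; apply: cvgD; first exact: cvg_cst.
by apply: cvgM; [exact: cvg_cst|exact: cvg_id].
Qed.

Definition on_rect (x1 x2 y1 y2 : R) (Q : C -> Prop) :=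
  forall x y, x1 <= x <= x2 -> y1 <= y <= y2 -> Q (x +i* y).

Lemma continuous_Complexl (x : R) : continuous (fun y : R => x +i* y : C).
Proof. by move=> y; apply: cvg_Complex; [exact: cvg_cst|exact: cvg_id]. Qed.

Lemma continuous_Complexr (y : R) : continuous (fun x : R => x +i* y : C).
Proof. by move=> x; apply: cvg_Complex; [exact: cvg_id|exact: cvg_cst]. Qed.

(* The imaginary part of the integral of [H] along the boundary. *)
Definition rect_flux (H : C -> C) (x1 x2 y1 y2 : R) : R :=
  (segint y1 y2 (fun y => Re (H (x2 +i* y))) - segint y1 y2 (fun y => Re (H (x1 +i* y)))) -
  (segint x1 x2 (fun x => Im (H (x +i* y2))) - segint x1 x2 (fun x => Im (H (x +i* y1)))).

Lemma cont_seg_vert (H : C -> C) x1 x2 y1 y2 x :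
  on_rect x1 x2 y1 y2 (fun z => {for z, continuous H}) -> x1 <= x <= x2 ->
  cont_seg y1 y2 (fun y => Re (H (x +i* y))).
Proof.
move=> cH xx y yy.
have K : {for y, continuous (fun y : R => H (x +i* y) : C)}.
  apply: (@continuous_comp _ _ _ (fun y : R => x +i* y : C) H).
    exact: continuous_Complexl.
  exact: cH.
exact: cvg_Re K.
Qed.

Lemma cont_seg_horiz (H : C -> C) x1 x2 y1 y2 y :
  on_rect x1 x2 y1 y2 (fun z => {for z, continuous H}) -> y1 <= y <= y2 ->
  cont_seg x1 x2 (fun x => Im (H (x +i* y))).
Proof.
move=> cH yy x xx.
have K : {for x, continuous (fun x : R => H (x +i* y) : C)}.
  apply: (@continuous_comp _ _ _ (fun x : R => x +i* y : C) H).
    exact: continuous_Complexr.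
  exact: cH.
exact: cvg_Im K.
Qed.

Lemma rect_fluxB (H G : C -> C) x1 x2 y1 y2 : x1 <= x2 -> y1 <= y2 ->
  on_rect x1 x2 y1 y2 (fun z => {for z, continuous H}) ->
  on_rect x1 x2 y1 y2 (fun z => {for z, continuous G}) ->
  rect_flux (fun z => H z - G z) x1 x2 y1 y2 =
  rect_flux H x1 x2 y1 y2 - rect_flux G x1 x2 y1 y2.
Proof.
move=> x12 y12 cH cG; rewrite /rect_flux.
have E1 x : x1 <= x <= x2 -> segint y1 y2 (fun y => Re (H (x +i* y) - G (x +i* y))) =
   segint y1 y2 (fun y => Re (H (x +i* y))) - segint y1 y2 (fun y => Re (G (x +i* y))).
  move=> xx; rewrite -segintB; [|exact: (cont_seg_vert cH)|exact: (cont_seg_vert cG)].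
  by apply: eq_segint => y _; rewrite raddfB.
have E2 y : y1 <= y <= y2 -> segint x1 x2 (fun x => Im (H (x +i* y) - G (x +i* y))) =
   segint x1 x2 (fun x => Im (H (x +i* y))) - segint x1 x2 (fun x => Im (G (x +i* y))).
  move=> xx; rewrite -segintB; [|exact: (cont_seg_horiz cH)|exact: (cont_seg_horiz cG)].
  by apply: eq_segint => y' _; rewrite raddfB.
rewrite !E1 ?E2 ?lexx ?x12 ?y12 //; ring.
Qed.

Lemma rect_flux_affine (k l : C) x1 x2 y1 y2 : x1 <= x2 -> y1 <= y2 ->
  rect_flux (fun z => k + l * z) x1 x2 y1 y2 = 0.
Proof.
move=> x12 y12; rewrite /rect_flux; case: k => k1 k2; case: l => l1 l2.
have E1 x : segint y1 y2 (fun y => Re ((k1 +i* k2) + (l1 +i* l2) * (x +i* y) : C)) =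
   (k1 + l1 * x) * (y2 - y1) + (- l2) * ((y2 ^+ 2 - y1 ^+ 2) / 2).
  rewrite -segint_affine //; apply: eq_segint => y _ /=; ring.
have E2 y : segint x1 x2 (fun x => Im ((k1 +i* k2) + (l1 +i* l2) * (x +i* y) : C)) =
   (k2 + l1 * y) * (x2 - x1) + l2 * ((x2 ^+ 2 - x1 ^+ 2) / 2).
  rewrite -segint_affine //; apply: eq_segint => x _ /=; ring.
rewrite !E1 !E2; ring.
Qed.

Lemma rect_flux_norm_le (H : C -> C) x1 x2 y1 y2 k : x1 <= x2 -> y1 <= y2 ->
  on_rect x1 x2 y1 y2 (fun z => {for z, continuous H}) ->
  on_rect x1 x2 y1 y2 (fun z => normc (H z) <= k) ->
  `|rect_flux H x1 x2 y1 y2| <= 2 * k * ((x2 - x1) + (y2 - y1)).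
Proof.
move=> x12 y12 cH Hk.
have E1 x : x1 <= x <= x2 -> `|segint y1 y2 (fun y => Re (H (x +i* y)))| <= k * (y2 - y1).
  move=> xx; apply: segint_norm_le => //; first exact: (cont_seg_vert cH).
  by move=> y yy; apply: le_trans (Hk _ _ xx yy); exact: normc_Re.
have E2 y : y1 <= y <= y2 -> `|segint x1 x2 (fun x => Im (H (x +i* y)))| <= k * (x2 - x1).
  move=> yy; apply: segint_norm_le => //; first exact: (cont_seg_horiz cH).
  by move=> x xx; apply: le_trans (Hk _ _ xx yy); exact: normc_Im.
apply: le_trans (ler_normB _ _) _.
apply: le_trans (lerD (ler_normB _ _) (ler_normB _ _)) _.
have := E1 x1; have := E1 x2; have := E2 y1; have := E2 y2; rewrite !lexx x12 y12 /=.
move=> /(_ isT) A /(_ isT) B /(_ isT) D /(_ isT) E; lra.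
Qed.

Lemma rect_flux_split (H : C -> C) a m b c n e : a <= m -> m <= b -> c <= n -> n <= e ->
  on_rect a b c e (fun z => {for z, continuous H}) ->
  rect_flux H a b c e = rect_flux H a m c n + rect_flux H m b c n +
    rect_flux H a m n e + rect_flux H m b n e.
Proof.
move=> am mb cn ne cH; rewrite /rect_flux.
have ab := le_trans am mb; have ce := le_trans cn ne.
rewrite (@segint_Chasles _ c e n _ cn ne (cont_seg_vert cH (x := b) _)); last by rewrite ab lexx.
rewrite (@segint_Chasles _ c e n _ cn ne (cont_seg_vert cH (x := a) _)); last by rewrite ab lexx.
rewrite (@segint_Chasles _ a b m _ am mb (cont_seg_horiz cH (y := e) _)); last by rewrite ce lexx.
rewrite (@segint_Chasles _ a b m _ am mb (cont_seg_horiz cH (y := c) _)); last by rewrite ce lexx.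
ring.
Qed.

Lemma normc_le_ReIm (z : R[i]) : normc z <= `|Re z| + `|Im z|.
Proof.
rewrite -(ler_pXn2r (n:=2)) ?nnegrE ?normc_ge0 ?addr_ge0 //.
rewrite normc_sqr sqrrD !real_normK ?num_real //.
rewrite lerD2r lerDl mulrn_wge0 // mulr_ge0 //.
Qed.

Theorem goursat_rect (H : C -> C) x1 x2 y1 y2 : x1 <= x2 -> y1 <= y2 ->
  on_rect x1 x2 y1 y2 (fun z => derivable H z 1) -> rect_flux H x1 x2 y1 y2 = 0.
Proof.
move=> x12 y12 dH.
have cH : on_rect x1 x2 y1 y2 (fun z => {for z, continuous H}).
  by move=> x y xx yy; apply: derivableC_continuous; exact: dH.
have subr a b c e Q : x1 <= a -> b <= x2 -> y1 <= c -> e <= y2 ->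
    on_rect x1 x2 y1 y2 Q -> on_rect a b c e Q.
  by move=> A B D E q x y xx yy; apply: q; lra.
have key eps : 0 < eps ->
    `|rect_flux H x1 x2 y1 y2| <= eps * ((x2 - x1) + (y2 - y1)) ^+ 2.
  (* The square of the half-perimeter is divided by four on each quarter, so the four bounds add up
     exactly to the bound on the whole. *)
  move=> e0; pose P a b c e := `|rect_flux H a b c e| <= eps * ((b - a) + (e - c)) ^+ 2.
  apply: (@rect_bisection P) => //.
    move=> a b c e xa ab bx yc ce ey; rewrite /P => p1 p2 p3 p4.
    have [m1 m2] : a <= (a + b) / 2 /\ (a + b) / 2 <= b by split; lra.
    have [n1 n2] : c <= (c + e) / 2 /\ (c + e) / 2 <= e by split; lra.
    rewrite (rect_flux_split m1 m2 n1 n2); last exact: (subr a b c e).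
    apply: le_trans (ler_normD _ _) _; apply: le_trans (lerD (ler_normD _ _) (lexx _)) _.
    apply: le_trans (lerD (lerD (ler_normD _ _) (lexx _)) (lexx _)) _.
    apply: le_trans (lerD (lerD (lerD p1 p2) p3) p4) _.
    by rewrite le_eqVlt; apply/orP; left; apply/eqP; field.
  move=> x y xx yy.
  have [d d0 dP] := derivableC_linear_approx (dH _ _ xx yy) (e := eps / 2) ltac:(by rewrite divr_gt0).
  exists (d / 2); first by rewrite divr_gt0.
  move=> a b c e xa xab bx yc yce ey bad ecd; rewrite /P.
  have ab : a <= b by lra.
  have ce : c <= e by lra.
  set z : C := x +i* y; set l : C := 'D_1 H z in dP *.
  pose k : C := H z - l * z.
  have cA : continuous (fun w : C => k + l * w).
    exact: continuous_affine.
  have cHr : on_rect a b c e (fun z => {for z, continuous H}) by exact: (subr a b c e).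
  (* The affine part has zero flux. The remainder is at most [eps / 2] times the half-perimeter, and
     the factor 2 in [rect_flux_norm_le] restores [eps]. *)
  have -> : rect_flux H a b c e = rect_flux (fun w => H w - (k + l * w)) a b c e.
    rewrite (rect_fluxB ab ce cHr (fun p q _ _ => cA (p +i* q))).
    by rewrite (rect_flux_affine k l ab ce) subr0.
  apply: le_trans (rect_flux_norm_le (k := eps / 2 * ((b - a) + (e - c))) ab ce _ _) _.
  - by move=> p q pp qq; apply: cvgB; [exact: cHr|exact: cA].
  - move=> p q pp qq.
    have wz : normc ((p +i* q) - z) <= (b - a) + (e - c).
      apply: le_trans (normc_le_ReIm _) _; rewrite /=.
      by apply: lerD; rewrite ler_norml; lra.
    have -> : H (p +i* q) - (k + l * (p +i* q)) =
        H (p +i* q) - H z - l * ((p +i* q) - z) by rewrite /k; ring.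
    apply: le_trans (dP _ _) _; first by apply: le_lt_trans wz _; lra.
    by rewrite ler_wpM2l // divr_ge0 // ltW.
  - by rewrite le_eqVlt; apply/orP; left; apply/eqP; field.
apply/eqP; rewrite -normr_le0; apply/ler_addgt0Pl => e e0; rewrite addr0.
set s := ((x2 - x1) + (y2 - y1)) ^+ 2 in key.
have s0 : 0 <= s by exact: sqr_ge0.
apply: le_trans (key (e / (s + 1)) _) _; first by rewrite divr_gt0 //; lra.
rewrite mulrAC ler_pdivrMr ?ler_pM2l //; lra.
Qed.

End Goursat.

(** * Complex exponential, and logarithm on the right half-plane *)

Section ComplexExpLog.
Variable R : realType.
Local Notation C := (R[i]^o).

Lemma derivableR_linear_approx (f : R -> R) (x l : R) : is_derive x 1 f l ->
  forall e : R, 0 < e -> exists2 d : R, 0 < d & forall y, `|y - x| < d ->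
  `|f y - f x - l * (y - x)| <= e * `|y - x|.
Proof.
move=> [+ +] e e0 => /[dup] df /cvgR_distP; rewrite -/(derive f x 1) => H fl.
have := H _ e0 => /nbhs_ballP[d /= d0 dP].
exists d => // y yx.
have [->|ynx] := eqVneq y x; first by rewrite !subrr mulr0 subr0 normr0 mulr0.
have yx0 : y - x != 0 by rewrite subr_eq0.
have := dP (y - x); rewrite /ball /= sub0r normrN => /(_ yx yx0).
have -> : (y - x) *: (1 : R) + x = y by rewrite /GRing.scale /= mulr1 subrK.
rewrite fl => /ltW hh.
have -> : f y - f x - l * (y - x) =
   ((y - x)^-1 *: (f y - f x) - l) * (y - x).
  by rewrite mulrBl /GRing.scale /= mulrAC mulVf // mul1r.
by rewrite normrM ler_wpM2r.
Qed.

Definition cexp (z : C) : C := (expR (Re z))%:C * cis (Im z).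

Lemma cexpD z w : cexp (z + w) = cexp z * cexp w.
Proof.
by rewrite /cexp !raddfD /= expRD cisD rmorphM /= mulrACA.
Qed.

Lemma normc_cexp z : normc (cexp z) = expR (Re z).
Proof.
by rewrite ComplexField.Normc.normcM normc_cis normc_real mulr1 ger0_norm ?expR_ge0.
Qed.

(** Derivability at 0 in disguise; the addition formula carries it to every point. The estimate also
    serves to differentiate the logarithm. *)
Lemma cexp_approx (e : R) : 0 < e -> exists2 d : R, 0 < d & forall h : C, normc h < d ->
  normc (cexp h - 1 - h) <= e * normc h.
Proof.
move=> e0; have e8 : 0 < e / 8 by rewrite divr_gt0.
have [d1 d10 A1] := derivableR_linear_approx (is_derive_expR 0) e8.
have [d2 d20 A2] := derivableR_linear_approx (is_derive_cos 0) e8.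
have [d3 d30 A3] := derivableR_linear_approx (is_derive_sin 0) e8.
exists (Num.min (Num.min d1 d2) (Num.min d3 (Num.min 1 (e / 8)))).
  by rewrite !lt_min d10 d20 d30 ltr01 e8.
move=> h; rewrite !lt_min => /andP[/andP[h1 h2] /andP[h3 /andP[h4 h5]]].
have hx := normc_Re h; have hy := normc_Im h.
case: h hx hy h1 h2 h3 h4 h5 => x y; rewrite [Re _]/= [Im _]/=.
set N := normc _ => hx hy h1 h2 h3 h4 h5.
have /= := A1 x; rewrite !subr0 expR0 mul1r => /(_ (le_lt_trans hx h1)) {A1}A1.
have /= := A2 y; rewrite !subr0 cos0 sin0 oppr0 mul0r subr0 => /(_ (le_lt_trans hy h2)) {A2}A2.
have /= := A3 y; rewrite !subr0 cos0 sin0 mul1r subr0 => /(_ (le_lt_trans hy h3)) {A3}A3.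
(* Expand [exp x] first, then [cis y] with weight [1 + x]. The leftover [i x y] is quadratic and is
   absorbed by [N < e / 8], while [N < 1] keeps [|1 + x|] below 2. *)
have -> : cexp (x +i* y) - 1 - (x +i* y) =
  (expR x - 1 - x)%:C * cis y + (1 + x)%:C * ((cos y - 1) +i* (sin y - y)) + (0 +i* (x * y)).
  rewrite /cexp /cis; apply/eqP; rewrite eq_complex /=; apply/andP; split; apply/eqP; ring.
apply: le_trans (normcD _ _) _; apply: le_trans (lerD (normcD _ _) (lexx _)) _.
rewrite !ComplexField.Normc.normcM normc_cis mulr1 !normc_real.
have B1 : normc ((cos y - 1) +i* (sin y - y)) <= e / 4 * `|y|.
  apply: le_trans (normc_le_ReIm _) _; rewrite /=; lra.
have B2 : `|1 + x| <= 2.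
  by apply: le_trans (ler_normD _ _) _; rewrite normr1; lra.
have B3 : normc (0 +i* (x * y)) <= e / 8 * `|y|.
  apply: le_trans (normc_le_ReIm _) _; rewrite /= normr0 add0r normrM ler_wpM2r //; lra.
have B4 : `|1 + x| * normc ((cos y - 1) +i* (sin y - y)) <= 2 * (e / 4 * `|y|).
  by apply: ler_pM => //; exact: normc_ge0.
have C1 : e * `|x| <= e * N by rewrite ler_pM2l.
have C2 : e * `|y| <= e * N by rewrite ler_pM2l.
have N0 : 0 <= e * N by rewrite mulr_ge0 ?normc_ge0 // ltW.
lra.
Qed.

Lemma derivable_cexp z : derivable cexp z 1.
Proof.
apply: (@derivableC_of_approx _ _ _ (cexp z)) => e e0.
have n0 : 0 < normc (cexp z) by rewrite normc_cexp expR_gt0.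
have [d d0 dP] := cexp_approx (divr_gt0 e0 n0).
exists d => // w /dP.
have -> : cexp w - cexp z - cexp z * (w - z) = cexp z * (cexp (w - z) - 1 - (w - z)).
  by rewrite !mulrBr mulr1 -cexpD [z + (w - z)]addrC subrK.
move=> H; rewrite ComplexField.Normc.normcM.
have -> : e * normc (w - z) = normc (cexp z) * (e / normc (cexp z) * normc (w - z)).
  by field; rewrite gt_eqF.
by rewrite ler_pM2l.
Qed.

Lemma derivableC_comp (f g : C -> C) z :
  derivable f z 1 -> derivable g (f z) 1 -> derivable (fun w => g (f w)) z 1.
Proof.
move=> /derivable1_diffP df /derivable1_diffP dg; apply/derivable1_diffP.
exact: (differentiable_comp df dg).
Qed.

Lemma derivableC_add (f g : C -> C) z :
  derivable f z 1 -> derivable g z 1 -> derivable (fun w => f w + g w : C) z 1.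
Proof. exact: derivableD. Qed.

Lemma derivableC_mul (f g : C -> C) z :
  derivable f z 1 -> derivable g z 1 -> derivable (fun w => f w * g w : C) z 1.
Proof. exact: derivableM. Qed.

Lemma derivableC_inv (f : C -> C) z :
  f z != 0 -> derivable f z 1 -> derivable (fun w => (f w)^-1 : C) z 1.
Proof. exact: derivableV. Qed.

Lemma derivableC_affine (k l : C) z : derivable (fun w : C => k + l * w : C) z 1.
Proof.
apply: (@derivableC_add (cst k)); first exact: derivable_cst.
by apply: (@derivableC_mul (cst l) id); [exact: derivable_cst|exact: derivable_id].
Qed.

Lemma derivableC_affineB (k l : C) z : derivable (fun w : C => k - l * w : C) z 1.
Proof.
have -> : (fun w : C => k - l * w : C) = (fun w => k + (- l) * w).
  by apply/funext => w; rewrite mulNr.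
exact: derivableC_affine.
Qed.

(** The formula used inside [cpow_rhp], so that [cpow_rhp u a] becomes [cexp (a%:C * clog u)]. It is
    the principal argument when [0 < Re u]. *)
Definition carg (u : C) : R := atan (Im u / Re u).

Definition clog (u : C) : C := ln (normc u) +i* carg u.

Lemma normc_gt0 (u : R[i]) : (0 < normc u) = (u != 0).
Proof.
rewrite lt_neqAle normc_ge0 andbT eq_sym; congr (~~ _).
apply/eqP/eqP => [/ComplexField.Normc.eq0_normc//|->]; exact: ComplexField.Normc.normc0.
Qed.

Lemma normc_gt0_Re (u : R[i]) : 0 < Re u -> 0 < normc u.
Proof. by move=> u0; apply: (lt_le_trans u0); rewrite -(ger0_norm (ltW u0)) normc_Re. Qed.

Lemma normc_cis_carg (u : C) : 0 < Re u -> (normc u)%:C * cis (carg u) = u.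
Proof.
move=> u0; have n0 := normc_gt0_Re u0.
have c0 : cos (carg u) = Re u / normc u.
  rewrite /carg cos_atan.
  have -> : 1 + (Im u / Re u) ^+ 2 = (normc u / Re u) ^+ 2.
    by rewrite !expr_div_n normc_sqr mulrDl divff // expf_neq0 // gt_eqF.
  by rewrite sqrtr_sqr ger0_norm ?invf_div // divr_ge0 // ltW.
have s0 : sin (carg u) = Im u / normc u.
  have := atanK (Im u / Re u); rewrite -/(carg u) /tan => /(congr1 (fun x => x * cos (carg u))).
  rewrite divfK; last by rewrite c0 mulf_neq0 // ?invr_eq0 gt_eqF.
  by move=> ->; rewrite c0 mulrA divfK // gt_eqF.
rewrite /cis c0 s0; apply/eqP; rewrite eq_complex /=.
by apply/andP; split; apply/eqP; field; rewrite gt_eqF.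
Qed.

Lemma clogK (u : C) : 0 < Re u -> cexp (clog u) = u.
Proof.
move=> u0; rewrite /cexp /= lnK ?posrE ?normc_gt0_Re //.
exact: normc_cis_carg.
Qed.

Lemma continuous_clog (u : C) : 0 < Re u -> {for u, continuous clog}.
Proof.
move=> u0; apply: cvg_Complex.
  have /= := @continuous_comp C R R (fun z : C => normc z) (@ln R) u.
  apply; first by apply: cvg_normc; exact: cvg_id.
  by apply: continuous_ln; exact: normc_gt0_Re.
have /= := @continuous_comp C R R (fun z : C => Im z / Re z) (@atan R) u.
apply; last exact: continuous_atan.
apply: cvgM; first by apply: cvg_Im; exact: cvg_id.
by apply: cvgV; [rewrite gt_eqF|apply: cvg_Re; exact: cvg_id].
Qed.

Lemma near_Re_gt0 (u : C) : 0 < Re u -> \forall w \near u, 0 < Re w.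
Proof.
move=> u0; apply/nbhsC_normcP; exists (Re u) => // w wu.
have := le_lt_trans (normc_Re _) wu; rewrite raddfB /= ltr_norml; lra.
Qed.

(** Inverse function argument: [k = clog w - clog u] satisfies [cexp k = w / u], so
    [v = (w - u) / u] differs from [k] by at most [e' |k|]; continuity of [clog] is what makes [k]
    small. *)
Lemma derivable_clog (u : C) : 0 < Re u -> derivable clog u 1.
Proof.
move=> u0; have n0 := normc_gt0_Re u0.
have un0 : u != 0 by rewrite -normc_gt0.
apply: (@derivableC_of_approx _ _ _ u^-1) => e e0.
(* The bound [1 / 2] gives [|k| <= 2 |v|]; the other one turns [2 e' |v|] into [e |w - u|]. *)
pose e' := Num.min (1 / 2) (e * normc u / 2).
have e'0 : 0 < e' by rewrite lt_min !divr_gt0 ?mulr_gt0.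
have [d d0 dP] := cexp_approx e'0.
have /cvgC_normcP /(_ _ d0) near1 : clog w @[w --> u] --> clog u.
  exact: continuous_clog.
have /nbhsC_normcP[r r0 rP] : \forall w \near u, normc (clog w - clog u) < d /\ 0 < Re w.
  by apply: filterI => //; exact: near_Re_gt0.
exists r => // w /rP[wd w0]; set v := (w - u) / u.
have -> : u^-1 * (w - u) = v by rewrite mulrC.
have vn : normc v = normc (w - u) / normc u.
  by rewrite ComplexField.Normc.normcM ComplexField.Normc.normcV.
have [k kE] : exists k : C, k = clog w - clog u by eexists.
rewrite -kE in wd *.
have vk : normc (v - k) <= e' * normc k.
  have -> : v - k = cexp k - 1 - k; last exact: dP.
  congr (_ - k); have -> : cexp k = w / u.
    apply: (mulIf un0); rewrite divfK // -[X in _ * X](clogK u0) -cexpD kE subrK.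
    exact: clogK.
  by rewrite /v mulrBl divff.
rewrite normcB; apply: (le_trans vk).
have e'1 : e' <= 1 / 2 by rewrite ge_min lexx.
have e'2 : e' <= e * normc u / 2 by rewrite ge_min lexx orbT.
have k2 : normc k <= 2 * normc v.
  have kv : normc k <= normc (v - k) + normc v.
    by rewrite normcB; have := normcD (k - v) v; rewrite subrK.
  have : e' * normc k <= 1 / 2 * normc k by rewrite ler_wpM2r // normc_ge0.
  lra.
apply: le_trans (ler_wpM2l (ltW e'0) k2) _.
apply: le_trans (ler_wpM2r _ e'2) _; first by rewrite mulr_ge0 ?normc_ge0.
by rewrite vn le_eqVlt; apply/orP; left; apply/eqP; field; rewrite gt_eqF.
Qed.

Lemma cpow_rhpE (u : C) (a : R) : 0 < Re u -> cpow_rhp u a = cexp (a%:C * clog u).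
Proof.
move=> u0; have n0 := normc_gt0_Re u0.
rewrite /cpow_rhp /cexp /clog /= !mul0r subr0 addr0 /powR gt_eqF //.
Qed.

Lemma derivable_cpow_rhp (u : C) (a : R) : 0 < Re u ->
  derivable ((cpow_rhp (R := R))^~ a : C -> C) u 1.
Proof.
move=> u0.
have : derivable (fun w : C => cexp (a%:C * clog w)) u 1.
  apply: (@derivableC_comp (fun w => a%:C * clog w)); last exact: derivable_cexp.
  by apply: (@derivableM _ _ (cst (a%:C : C)) clog); [exact: derivable_cst|exact: derivable_clog].
apply: near_eq_derivable.
by have := near_Re_gt0 u0; apply: filterS => w /cpow_rhpE ->.
Qed.

End ComplexExpLog.

(** * Means over circles and the mean value property *)

Section CircleMean.
Variable R : realType.
Local Notation C := (R[i]^o).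
Implicit Types f g : R -> R.

Definition mean f : R := (2 * pi)^-1 * segint 0 (2 * pi) f.

Lemma twopi_gt0 : 0 < 2 * pi :> R.
Proof. by rewrite mulr_gt0 ?pi_gt0. Qed.

Lemma twopi_ge0 : 0 <= 2 * pi :> R.
Proof. exact: ltW twopi_gt0. Qed.

Lemma eq_mean f g : (forall t, f t = g t) -> mean f = mean g.
Proof. by move=> /funext ->. Qed.

Lemma meanD f g : continuous f -> continuous g ->
  mean (fun t => f t + g t) = mean f + mean g.
Proof. by move=> cf cg; rewrite /mean segintD ?mulrDr //; exact: cont_segT. Qed.

Lemma meanB f g : continuous f -> continuous g ->
  mean (fun t => f t - g t) = mean f - mean g.
Proof. by move=> cf cg; rewrite /mean segintB ?mulrBr //; exact: cont_segT. Qed.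

Lemma meanZ f k : continuous f -> mean (fun t => k * f t) = k * mean f.
Proof. by move=> cf; rewrite /mean segintZ 1?mulrCA //; exact: cont_segT. Qed.

Lemma mean_cst k : mean (fun=> k) = k.
Proof.
by rewrite /mean segint_cst ?twopi_ge0 // subr0 mulrC mulfK // gt_eqF ?twopi_gt0.
Qed.

Lemma le_mean f g : continuous f -> continuous g ->
  (forall t, f t <= g t) -> mean f <= mean g.
Proof.
move=> cf cg fg; rewrite /mean ler_pM2l ?invr_gt0 ?twopi_gt0 //.
by apply: le_segint; [exact: cont_segT|exact: cont_segT|].
Qed.

Lemma mean_ge0 f : continuous f -> (forall t, 0 <= f t) -> 0 <= mean f.
Proof.
by move=> cf f0; rewrite -(mean_cst 0); apply: le_mean => //; move=> t; exact: cvg_cst.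
Qed.

Lemma mean_dist_le f g k : continuous f -> continuous g ->
  (forall t, `|f t - g t| <= k) -> `|mean f - mean g| <= k.
Proof.
move=> cf cg fk; rewrite -meanB //.
have cfg : continuous (fun t => f t - g t) by move=> t; apply: cvgB; [exact: cf|exact: cg].
have ck (k' : R) : continuous (fun _ : R => k') by move=> t; exact: cvg_cst.
rewrite ler_norml; have := mean_cst (- k); have := mean_cst k => kE nkE.
rewrite -{1}nkE -{2}kE.
by apply/andP; split; apply: le_mean => // t; have := fk t; rewrite ler_norml => /andP[].
Qed.

Lemma continuous_bigsum (I : Type) (s : seq I) (F : I -> R -> R) :
  (forall i, continuous (F i)) -> continuous (fun t => \sum_(i <- s) F i t).
Proof.
move=> cF; elim: s => [|j s IH].
  have -> : (fun t => \sum_(i <- [::]) F i t) = (fun=> 0) by apply/funext => t; rewrite big_nil.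
  by move=> t; exact: cvg_cst.
have -> : (fun t => \sum_(i <- j :: s) F i t) = (fun t => F j t + \sum_(i <- s) F i t).
  by apply/funext => t; rewrite big_cons.
by move=> t; apply: cvgD; [exact: cF|exact: IH].
Qed.

Lemma mean_sum (I : Type) (s : seq I) (F : I -> R -> R) : (forall i, continuous (F i)) ->
  mean (fun t => \sum_(i <- s) F i t) = \sum_(i <- s) mean (F i).
Proof.
move=> cF; elim: s => [|i s IH].
  by rewrite big_nil -[RHS](mean_cst 0); apply: eq_mean => t; rewrite big_nil.
rewrite big_cons -IH -meanD //; last exact: continuous_bigsum.
by apply: eq_mean => t; rewrite big_cons.
Qed.

Lemma mean_shift f s : continuous f -> (forall t, f (t + 2 * pi) = f t) ->
  mean (fun t => f (t + s)) = mean f.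
Proof.
(* For negative [s] the shifted function is again continuous and periodic, and shifting it by [- s]
   gives back [f]. *)
wlog s0 : f s / 0 <= s.
  move=> W cf pf; have [|s0] := leP 0 s; first by move=> ?; exact: W.
  have cfs : continuous (fun t => f (t + s)).
    move=> t; apply: (@continuous_comp _ _ _ (fun t : R => t + s) f); last exact: cf.
    by apply: cvgD; [exact: cvg_id|exact: cvg_cst].
  rewrite -(W (fun t => f (t + s)) (- s)) //; last by move=> t; rewrite addrAC pf.
    by apply: eq_mean => t; rewrite subrK.
  by rewrite oppr_ge0 ltW.
move=> cf pf; rewrite /mean segint_shift ?twopi_ge0 // add0r; congr (_ * _).
have cs a b : cont_seg a b f by exact: cont_segT.
have p0 := twopi_ge0.
have E1 := @segint_Chasles _ 0 (2 * pi + s) s f s0 ltac:(by rewrite lerDr) (cs _ _).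
have E2 := @segint_Chasles _ 0 (2 * pi + s) (2 * pi) f p0 ltac:(by rewrite lerDl) (cs _ _).
have E3 : segint (2 * pi) (2 * pi + s) f = segint 0 s f.
  rewrite [2 * pi + s]addrC -{1}[2 * pi]add0r -segint_shift //.
  by apply: eq_segint => t _; rewrite pf.
lra.
Qed.

Lemma continuous_circle (a : C) (r : R) : continuous (fun t : R => a + r%:C * cis t : C).
Proof.
move=> t; apply: cvgD; first exact: cvg_cst.
by apply: cvgM; [exact: cvg_cst|exact: continuous_cis].
Qed.

Lemma normc_circle (a : C) (r t : R) : 0 <= r -> normc (a + r%:C * cis t - a) = r.
Proof.
move=> r0; rewrite [a + _]addrC addrK ComplexField.Normc.normcM normc_cis mulr1.
by rewrite normc_real ger0_norm.
Qed.

Lemma continuous_on_circle (T : topologicalType) (F : C -> T) (a : C) (r : R) : 0 <= r ->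
  (forall w, normc (w - a) <= r -> {for w, continuous F}) ->
  continuous (fun t : R => F (a + r%:C * cis t)).
Proof.
move=> r0 cF t; apply: (@continuous_comp _ _ _ (fun t : R => a + r%:C * cis t : C) F).
  exact: continuous_circle.
by apply: cF; rewrite normc_circle.
Qed.

(** The rectangle between [ln s] and [ln r], of height [2 pi], is wrapped by [a + cexp z] around an
    annulus. Its horizontal sides cancel by periodicity and its vertical sides give the circle
    integrals, so the mean is the same for radii [s] and [r]. As [s] tends to 0, continuity at [a]
    gives the value. *)
Theorem mean_value (G : C -> C) (a : C) (r : R) : 0 <= r ->
  (forall w, normc (w - a) <= r -> derivable G w 1) ->
  mean (fun t => Re (G (a + r%:C * cis t))) = Re (G a).
Proof.
rewrite le_eqVlt => /predU1P[<- _|r0 dG].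
  by rewrite -[RHS]mean_cst; apply: eq_mean => t; rewrite mul0r addr0.
pose H (z : C) : C := G (a + cexp z).
have dH z : Re z <= ln r -> derivable H z 1.
  move=> zr; apply: (@derivableC_comp _ (fun z => a + cexp z)).
    by apply: (@derivableD _ _ _ (cst a) (@cexp R)); [exact: derivable_cst|exact: derivable_cexp].
  by apply: dG; rewrite addrC addKr normc_cexp -ler_ln ?posrE ?expR_gt0 // expRK.
have cG w : normc (w - a) <= r -> {for w, continuous G}.
  by move=> wr; apply: derivableC_continuous; exact: dG.
have cmG s : 0 <= s -> s <= r -> continuous (fun t => Re (G (a + s%:C * cis t))).
  move=> s0 sr t; apply: cvg_Re.
  apply: (@continuous_on_circle _ G a s s0 _ t) => w ws; apply: cG; exact: le_trans ws sr.
have cst_mean s : 0 < s -> s <= r ->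
    mean (fun t => Re (G (a + r%:C * cis t))) = mean (fun t => Re (G (a + s%:C * cis t))).
  move=> s0 sr; rewrite /mean; congr (_ * _).
  have lsr : ln s <= ln r by rewrite ler_ln ?posrE.
  have : rect_flux H (ln s) (ln r) 0 (2 * pi) = 0.
    by apply: goursat_rect; rewrite ?twopi_ge0 // => x y xx _; apply: dH => /=; lra.
  rewrite /rect_flux.
  have E (q : R) : 0 < q ->
      segint 0 (2 * pi) (fun y => Re (H (ln q +i* y))) =
      segint 0 (2 * pi) (fun t => Re (G (a + q%:C * cis t))).
    by move=> q0; apply: eq_segint => y _; rewrite /H /cexp /= lnK.
  rewrite !E //.
  have -> : segint (ln s) (ln r) (fun x => Im (H (x +i* (2 * pi)))) =
            segint (ln s) (ln r) (fun x => Im (H (x +i* 0))).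
    by apply: eq_segint => x _; rewrite /H /cexp /= -{1}[2 * pi]add0r cis2pi.
  by rewrite subrr subr0 => /eqP; rewrite subr_eq0 => /eqP.
apply/eqP; rewrite -subr_eq0 -normr_le0; apply/ler_addgt0Pl => e e0; rewrite addr0.
have /cvgC_normcP /(_ _ e0) /nbhsC_normcP[d d0 dP] : {for a, continuous G}.
  by apply: cG; rewrite subrr ComplexField.Normc.normc0 ltW.
pose s := Num.min r (d / 2).
have s0 : 0 < s by rewrite lt_min r0 divr_gt0.
have sr : s <= r by rewrite ge_min lexx.
have sd : s < d by rewrite gt_min; apply/orP; right; lra.
rewrite (cst_mean s) // -[X in _ - X](mean_cst).
apply: mean_dist_le; first exact: cmG (ltW s0) sr.
  by move=> t; exact: cvg_cst.
move=> t; rewrite -raddfB; apply: le_trans (normc_Re _) _; apply/ltW/dP.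
by rewrite normc_circle // ltW.
Qed.

End CircleMean.

(** * Compactness of the closed disc and Riemann sums over circles *)

Section DiscCompactness.
Variable R : realType.
Local Notation C := (R[i]^o).

Lemma unit_cisP (u : C) : normc u = 1 -> exists2 t : R, 0 <= t <= 2 * pi & u = cis t.
Proof.
move=> u1; have := normc_sqr u; rewrite u1 expr1n => /esym xy1.
have x1 : -1 <= Re u <= 1 by have := normc_Re u; rewrite u1 ler_norml.
have p0 : 0 <= pi :> R by exact: pi_ge0.
have a0 := acos_ge0 x1; have api := acos_lepi x1.
have ca : cos (acos (Re u)) = Re u by apply: acosK; rewrite in_itv.
have sa : sin (acos (Re u)) = `|Im u|.
  rewrite sin_acos // -xy1 addrC addKr sqrtr_sqr //.
have [y0|y0] := leP 0 (Im u).
  exists (acos (Re u)); first lra.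
  by rewrite /cis ca sa ger0_norm //; case: (u).
exists (2 * pi - acos (Re u)); first lra.
rewrite [2 * pi - _]addrC cis2pi /cis cosN sinN ca sa ltr0_norm // opprK.
by case: (u).
Qed.

Lemma polar_decomposition (z : C) :
  exists2 t : R, 0 <= t <= 2 * pi & z = (normc z)%:C * cis t.
Proof.
have [->|z0] := eqVneq z 0.
  by exists 0; rewrite ?lexx ?twopi_ge0 // ComplexField.Normc.normc0 mul0r.
have n0 : 0 < normc z by rewrite normc_gt0.
have nz : (normc z)%:C != 0 :> C by rewrite -normc_gt0 normc_real ger0_norm // ltW.
have [|t tp tE] := @unit_cisP (z / (normc z)%:C).
  rewrite ComplexField.Normc.normcM ComplexField.Normc.normcV normc_real.
  by rewrite ger0_norm ?ltW // divff // gt_eqF.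
by exists t => //; rewrite -tE mulrC divfK.
Qed.

Definition closed_disc (s : R) : set C := [set z | normc z <= s].

(** Polar coordinates present the disc as a continuous image of a product of two segments; for
    [s < 0] both sides are empty. *)
Lemma compact_closed_disc s : compact (closed_disc s).
Proof.
pose f (q : R * R) : C := q.1%:C * cis q.2.
have cf : continuous f.
  move=> q; apply: cvgM; first by apply: cvg_real_complex; exact: cvg_fst.
  apply: (@continuous_comp _ _ _ snd (@cis R)); first exact: cvg_snd.
  exact: continuous_cis.
have -> : closed_disc s = f @` (`[0, s] `*` `[0, 2 * pi]).
  apply/seteqP; split => [z zs|].
    have [t tp zE] := polar_decomposition z.
    by exists (normc z, t) => //; split; rewrite /= in_itv //= normc_ge0.
  move=> _ [[r t] /= [+ _] <-]; rewrite in_itv /= => /andP[r0 rs].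
  by rewrite /closed_disc /= ComplexField.Normc.normcM normc_cis mulr1 normc_real ger0_norm.
apply: continuous_compact; first exact: continuous_subspaceT.
by apply: compact_setX; exact: segment_compact.
Qed.

Lemma disc_EVT_max (v : C -> R) s : 0 <= s ->
  (forall z, normc z <= s -> {for z, continuous v}) ->
  exists2 z0, normc z0 <= s & forall z, normc z <= s -> v z <= v z0.
Proof.
move=> s0 cv.
have D0 : closed_disc s !=set0 by exists 0; rewrite /closed_disc /= ComplexField.Normc.normc0.
have cvD : {within closed_disc s, continuous v}.
  by apply: continuous_in_subspaceT => z /set_mem; exact: cv.
have [c cs cP] := compact_EVT_max D0 (compact_closed_disc (s := s)) cvD.
by exists c => [|z zs]; [exact: set_mem cs|apply: cP; exact: mem_set].
Qed.

(** Only [z] is confined to the disc: continuity at its points is two-sided, so [w] may lie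
    outside. *)
Lemma disc_unif_continuous (G : C -> C) s (e : R) : 0 < e ->
  (forall z, normc z <= s -> {for z, continuous G}) ->
  exists2 d : R, 0 < d & forall z w, normc z <= s -> normc (w - z) < d ->
    normc (G w - G z) < e.
Proof.
move=> e0 cG.
have e20 : 0 < e / 2 by rewrite divr_gt0.
pose P (d : R) (z : C) := forall w, normc (w - z) < d -> normc (G w - G z) < e.
have : \forall d \near (0 : R)^'+, closed_disc s `<=` P d.
  have := compact_closed_disc (s := s); rewrite compact_near_coveringP.
  apply => z zs.
  have /cvgC_normcP /(_ _ e20) /nbhsC_normcP[d0 d00 dP] := cG _ zs.
  exists ([set z' | normc (z' - z) < d0 / 2], [set d | d < d0 / 2]).
    split; first by apply/nbhsC_normcP; exists (d0 / 2) => //; rewrite divr_gt0.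
    by apply: nbhs_right_lt; rewrite divr_gt0.
  move=> [z' d] [/= z'z dd] w wz'.
  have A : normc (G w - G z) < e / 2.
    apply: dP; have := normcD (w - z') (z' - z); rewrite addrA subrK; lra.
  have B : normc (G z' - G z) < e / 2 by apply: dP; lra.
  have := normcD (G w - G z) (G z - G z'); rewrite addrA subrK normcB.
  by rewrite [normc (G z - _)]normcB; lra.
move=> near1.
have [d [d0 dP]] := filter_ex (filterI (nbhs_right_gt (0 : R)) near1).
by exists d => // z w zs; exact: (dP z zs).
Qed.

Lemma disc_unif_continuousR (g : C -> R) s (e : R) : 0 < e ->
  (forall z, normc z <= s -> {for z, continuous g}) ->
  exists2 d : R, 0 < d & forall z w, normc z <= s -> normc (w - z) < d ->
    `|g w - g z| < e.
Proof.
move=> e0 cg.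
have [|d d0 dP] := @disc_unif_continuous (fun z => (g z)%:C) s e e0.
  by move=> z zs; apply: cvg_real_complex; exact: cg.
by exists d => // z w zs wz; rewrite -normc_real raddfB; exact: dP.
Qed.

Lemma unif_continuous_cis (e : R) : 0 < e -> exists2 d : R, 0 < d &
  forall s t : R, `|s - t| < d -> normc (cis s - cis t) < e.
Proof.
move=> e0; have /cvgC_normcP /(_ _ e0) /nbhs_ballP[d /= d0 dP] := @continuous_cis R 0.
exists d => // s t st.
have -> : cis s - cis t = cis t * (cis (s - t) - cis 0).
  by rewrite mulrBr -!cisD addr0 [t + (s - t)]addrC subrK.
rewrite ComplexField.Normc.normcM normc_cis mul1r; apply: dP.
by rewrite /ball /= sub0r normrN.
Qed.

(** For [f t = v (z * cis t)] this is the average of [v] over the rotations of [z] by the [n]-th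
    roots of unity. *)
Definition riemann_sum (f : R -> R) (n : nat) : R :=
  n%:R^-1 * \sum_(j < n) f (2 * pi * (j%:R / n%:R)).

Lemma riemann_sum_mean (f : R -> R) (n : nat) (e : R) : (0 < n)%N -> continuous f ->
  (forall s t : R, `|s - t| <= 2 * pi / n%:R -> `|f s - f t| <= e) ->
  `|riemann_sum f n - mean f| <= e.
Proof.
move=> n0 cf fe.
have cs a b : cont_seg a b f by exact: cont_segT.
have nn0 : 0 < n%:R :> R by rewrite ltr0n.
have p0 := @twopi_gt0 R.
pose th j : R := 2 * pi * (j%:R / n%:R); set h := 2 * pi / n%:R in fe.
have h0 : 0 < h by rewrite divr_gt0.
have thS j : th j.+1 = th j + h.
  by rewrite /th /h -[j.+1%:R]natr1; field; rewrite gt_eqF.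
have th0 : th 0%N = 0 by rewrite /th mul0r mulr0.
have thge j : 0 <= th j by elim: j => [|j IH]; rewrite ?th0 // thS addr_ge0 // ltW.
have split_sum m : `|h * \sum_(j < m) f (th j) - segint 0 (th m) f| <= e * th m.
  elim: m => [|m IH]; first by rewrite big_ord0 mulr0 th0 segint0 subrr normr0 mulr0.
  rewrite big_ord_recr /= (@segint_Chasles _ 0 (th m.+1) (th m)) //; last first.
    by rewrite thS lerDl ltW.
  have hm : th m.+1 - th m = h by rewrite thS addrC addKr.
  have thm : th m <= th m.+1 by rewrite thS lerDl ltW.
  have B : `|f (th m) * h - segint (th m) (th m.+1) f| <= e * h.
    rewrite -hm -segint_cst // -segintB //; last exact: cont_seg_cst.
    apply: segint_norm_le => //.
      by move=> x _; apply: cvgB; [exact: cvg_cst|exact: cf].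
    move=> x xx; apply: fe; rewrite distrC ger0_norm; move: xx; rewrite thS; lra.
  have -> : h * (\sum_(j < m) f (th j) + f (th m)) -
      (segint 0 (th m) f + segint (th m) (th m.+1) f) =
      (h * \sum_(j < m) f (th j) - segint 0 (th m) f) +
      (f (th m) * h - segint (th m) (th m.+1) f) by ring.
  by apply: le_trans (ler_normD _ _) _; rewrite {2}thS mulrDr lerD.
have thn : th n = 2 * pi by rewrite /th divff ?mulr1 // gt_eqF.
have := split_sum n; rewrite thn => H.
have -> : riemann_sum f n - mean f =
    (2 * pi)^-1 * (h * \sum_(j < n) f (th j) - segint 0 (2 * pi) f).
  by rewrite /riemann_sum /mean /h mulrBr mulrA mulrA mulVf ?mul1r // gt_eqF.
by rewrite normrM gtr0_norm ?invr_gt0 // mulrC ler_pdivrMr.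
Qed.

(** The rank does not depend on [z]. This is essential: it is fixed before the maximum point in
    [circle_mean_le] is known, and before [z] in [poisson_sum_le]. *)
Lemma riemann_sum_circle (v : C -> R) s (e : R) : 0 < e ->
  (forall z, normc z <= s -> {for z, continuous v}) ->
  exists n0 : nat, forall n, (n0 <= n)%N -> forall z, normc z <= s ->
    `|riemann_sum (fun t => v (z * cis t)) n - mean (fun t => v (z * cis t))| <= e.
Proof.
move=> e0 cv.
have [d d0 dP] := disc_unif_continuousR e0 cv.
have p0 := @twopi_gt0 R.
have s10 : 0 < `|s| + 1 by rewrite ltr_wpDl.
have [d' d'0 d'P] := unif_continuous_cis (divr_gt0 d0 s10).
have q0 : 0 <= 2 * pi / d' by rewrite divr_ge0 // ltW.
exists (Num.truncn (2 * pi / d')).+1 => n n0 z zs.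
have nd : 2 * pi / n%:R < d'.
  have nr : 2 * pi / d' < n%:R by apply: (lt_le_trans (truncnS_gt _)); rewrite ler_nat.
  have nn0 := le_lt_trans q0 nr.
  by rewrite ltr_pdivrMr // [_ * n%:R]mulrC -ltr_pdivrMr.
have zt t : normc (z * cis t) <= s.
  by rewrite ComplexField.Normc.normcM normc_cis mulr1.
apply: riemann_sum_mean; first by case: n n0 {nd}.
  move=> t; apply: (@continuous_comp _ _ _ (fun t : R => z * cis t : C) v); last exact: cv.
  by apply: cvgM; [exact: cvg_cst|exact: continuous_cis].
move=> a b ab; apply/ltW/dP => //; rewrite -mulrBr ComplexField.Normc.normcM.
have H := d'P _ _ (le_lt_trans ab nd).
apply: (@le_lt_trans _ _ ((`|s| + 1) * normc (cis a - cis b))).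
  rewrite ler_wpM2r ?normc_ge0 //; have := ler_norm s; lra.
by rewrite mulrC -ltr_pdivlMr.
Qed.

End DiscCompactness.

(** * Subharmonicity of [|F|^q] and growth of circle means *)

Section Subharmonic.
Variable R : realType.
Local Notation C := (R[i]^o).
Implicit Types v : C -> R.

(** Restricted to small circles: [|F|^q] is compared with a harmonic function only near [z], and the
    maximum principle asks for no more. *)
Definition sub_mean_at v (z : C) := exists2 d : R, 0 < d &
  forall r, 0 < r -> r < d -> v z <= mean (fun t => v (z + r%:C * cis t)).

Definition subharmonic_disc (s : R) v :=
  (forall z : C, normc z <= s -> {for z, continuous v}) /\
  (forall z : C, normc z < s -> sub_mean_at v z).

Lemma circle_in_disc (s r t : R) (z : C) : 0 <= r -> r <= s - normc z ->
  normc (z + r%:C * cis t) <= s.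
Proof.
move=> r0 rs; apply: le_trans (normcD _ _) _.
by rewrite ComplexField.Normc.normcM normc_cis mulr1 normc_real ger0_norm //; lra.
Qed.

Lemma continuous_on_inner_circle s v (z : C) r : 0 <= r -> r <= s - normc z ->
  (forall z : C, normc z <= s -> {for z, continuous v}) ->
  continuous (fun t => v (z + r%:C * cis t)).
Proof.
move=> r0 rs cv; apply: continuous_on_circle => // w wz; apply: cv.
by have := normcD (w - z) z; rewrite subrK; lra.
Qed.

Lemma subharmonic_discD s v (w : C -> R) : subharmonic_disc s v -> subharmonic_disc s w ->
  subharmonic_disc s (fun z => v z + w z).
Proof.
move=> [cv mv] [cw mw]; split=> z zs; first by apply: cvgD; [exact: cv|exact: cw].
have [d d0 dP] := mv _ zs; have [e e0 eP] := mw _ zs.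
exists (Num.min (s - normc z) (Num.min d e)); first by rewrite !lt_min d0 e0 subr_gt0 zs.
move=> r r0; rewrite !lt_min => /andP[rs /andP[rd re]].
rewrite meanD; first by apply: lerD; [exact: dP|exact: eP].
- exact: (continuous_on_inner_circle (ltW r0) (ltW rs)).
- exact: (continuous_on_inner_circle (ltW r0) (ltW rs)).
Qed.

Lemma subharmonic_discZ s v k : 0 <= k -> subharmonic_disc s v ->
  subharmonic_disc s (fun z => k * v z).
Proof.
move=> k0 [cv mv]; split=> z zs; first by apply: cvgM; [exact: cvg_cst|exact: cv].
have [d d0 dP] := mv _ zs.
exists (Num.min (s - normc z) d); first by rewrite !lt_min d0 subr_gt0 zs.
move=> r r0; rewrite lt_min => /andP[rs rd].
rewrite meanZ; first by rewrite ler_wpM2l // dP.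
exact: (continuous_on_inner_circle (ltW r0) (ltW rs)).
Qed.

Lemma subharmonic_disc0 s : subharmonic_disc s (fun=> 0).
Proof.
split=> z _; first exact: cvg_cst.
by exists 1 => // r _ _; rewrite mean_cst.
Qed.

Lemma subharmonic_disc_sum (I : Type) (l : seq I) s (V : I -> C -> R) :
  (forall i, subharmonic_disc s (V i)) ->
  subharmonic_disc s (fun z => \sum_(i <- l) V i z).
Proof.
move=> sV; elim: l => [|i l IH].
  have -> : (fun z => \sum_(i <- [::]) V i z) = (fun=> 0).
    by apply/funext => z; rewrite big_nil.
  exact: subharmonic_disc0.
have -> : (fun z => \sum_(j <- i :: l) V j z) = (fun z => V i z + \sum_(j <- l) V j z).
  by apply/funext => z; rewrite big_cons.
exact: subharmonic_discD.
Qed.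

Lemma subharmonic_disc_rot s v th : subharmonic_disc s v ->
  subharmonic_disc s (fun z => v (z * cis th)).
Proof.
have nz (z : C) : normc (z * cis th) = normc z.
  by rewrite ComplexField.Normc.normcM normc_cis mulr1.
move=> [cv mv]; split=> z zs.
  apply: (@continuous_comp _ _ _ (fun z : C => z * cis th : C) v).
    by apply: cvgM; [exact: cvg_id|exact: cvg_cst].
  by apply: cv; rewrite nz.
have [|d d0 dP] := mv (z * cis th); first by rewrite nz.
exists (Num.min (s - normc z) d); first by rewrite !lt_min d0 subr_gt0 zs.
move=> r r0; rewrite lt_min => /andP[rs rd]; apply: le_trans (dP _ r0 rd) _.
have cz : continuous (fun t => v (z * cis th + r%:C * cis t)).
  by apply: (continuous_on_inner_circle (ltW r0)) cv; rewrite nz ltW.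
rewrite -(mean_shift th cz); last by move=> t; rewrite cis2pi.
by rewrite le_eqVlt; apply/orP; left; apply/eqP/eq_mean => t; rewrite cisD mulrDl mulrA.
Qed.

(** The cross term is the real part of a holomorphic function vanishing at 0, hence has mean 0. The
    excess [r^2] is the strictness exploited in [subharmonic_disc_max]. *)
Lemma mean_normc_sqr (z : C) (r : R) : 0 <= r ->
  mean (fun t => normc (z + r%:C * cis t) ^+ 2) = normc z ^+ 2 + r ^+ 2.
Proof.
move=> r0.
have -> : (fun t => normc (z + r%:C * cis t) ^+ 2) =
    (fun t => normc z ^+ 2 + r ^+ 2 + 2 * Re (z^* * (0 + r%:C * cis t))).
  apply/funext => t; rewrite !normc_sqr; case: z => x y /=.
  by have := cos2Dsin2 t; nra.
have cG : continuous (fun t => Re (z^* * (0 + r%:C * cis t))).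
  move=> t; apply: cvg_Re; apply: cvgM; first exact: cvg_cst.
  exact: (@continuous_circle _ 0 r).
rewrite meanD; last 2 first.
- by move=> t; exact: cvg_cst.
- by move=> t; apply: cvgM; [exact: cvg_cst|exact: cG].
rewrite mean_cst meanZ // (@mean_value _ (fun w => z^* * w)) //.
  by rewrite mulr0 /= mulr0 addr0.
Qed.

Lemma continuous_normc_sqr : continuous (fun z : C => normc z ^+ 2).
Proof.
move=> z; have c : normc w @[w --> z] --> normc z by apply: cvg_normc; exact: cvg_id.
exact: (cvgM c c).
Qed.

(** Adding [k |z|^2] makes the sub-mean inequality strict, so a maximum point of the perturbed
    function cannot be interior. The perturbation costs at most [k s^2 <= e]. *)
Lemma subharmonic_disc_max s v e : 0 <= s -> 0 < e -> subharmonic_disc s v ->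
  exists2 z0, normc z0 = s & forall z, normc z <= s -> v z <= v z0 + e.
Proof.
move=> s0 e0 [cv mv].
have s1 : 0 < s ^+ 2 + 1 by rewrite ltr_wpDl // sqr_ge0.
pose k := e / (s ^+ 2 + 1); have k0 : 0 < k by rewrite divr_gt0.
pose V z := v z + k * normc z ^+ 2.
have cV z : normc z <= s -> {for z, continuous V}.
  move=> zs; apply: cvgD; first exact: cv.
  by apply: cvgM; [exact: cvg_cst|exact: continuous_normc_sqr].
have [z0 z0s z0P] := disc_EVT_max s0 cV.
have [z0E|z0ne] := eqVneq (normc z0) s.
  exists z0 => // z zs; have := z0P _ zs; rewrite /V z0E.
  have : k * s ^+ 2 <= e.
    by rewrite /k mulrAC ler_pdivrMr // ler_pM2l // lerDl.
  have : 0 <= k * normc z ^+ 2 by rewrite mulr_ge0 ?sqr_ge0 // ltW.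
  lra.
have {z0ne}z0lt : normc z0 < s by rewrite lt_neqAle z0ne.
have [d d0 dP] := mv _ z0lt.
pose r := Num.min (s - normc z0) d / 2.
have m0 : 0 < Num.min (s - normc z0) d by rewrite lt_min subr_gt0 z0lt.
have r0 : 0 < r by rewrite divr_gt0.
have [rs rd] : r <= s - normc z0 /\ r < d.
  have : Num.min (s - normc z0) d <= s - normc z0 by rewrite ge_min lexx.
  have : Num.min (s - normc z0) d <= d by rewrite ge_min lexx orbT.
  by rewrite /r; lra.
have := dP _ r0 rd.
have c1 := continuous_on_inner_circle (ltW r0) rs cv.
have c2 := continuous_on_inner_circle (ltW r0) rs (fun z _ => @continuous_normc_sqr z).
have c3 := continuous_on_inner_circle (ltW r0) rs cV.
have : mean (fun t => V (z0 + r%:C * cis t)) <= V z0.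
  rewrite -[leRHS]mean_cst; apply: le_mean => //; first by move=> t; exact: cvg_cst.
  by move=> t; apply: z0P; apply: circle_in_disc => //; exact: ltW.
rewrite /V meanD //; last by move=> t; apply: cvgM; [exact: cvg_cst|exact: c2].
rewrite meanZ // (mean_normc_sqr z0 (ltW r0)) mulrDr.
by have : 0 < k * r ^+ 2; [rewrite mulr_gt0 // exprn_gt0|lra].
Qed.

(** A finite average of rotations [V] is subharmonic as a finite sum and is within [e / 3] of the
    circle mean, so the maximum principle for [V] compares the two radii. The three thirds are two
    Riemann errors and the loss in the maximum principle. *)
Theorem circle_mean_le s1 s v : 0 <= s1 -> s1 <= s -> subharmonic_disc s v ->
  mean (fun t => v (s1%:C * cis t)) <= mean (fun t => v (s%:C * cis t)).
Proof.
move=> s10 s1s sv; have [cv mv] := sv.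
have s0 := le_trans s10 s1s.
apply/ler_addgt0Pl => e e0; have e3 : 0 < e / 3 by rewrite divr_gt0.
have [n nP] := riemann_sum_circle e3 cv; have {}nP := nP _ (leqnn n).
pose V z := riemann_sum (fun t => v (z * cis t)) n.
have sV : subharmonic_disc s V.
  apply: subharmonic_discZ; first by rewrite invr_ge0.
  by apply: subharmonic_disc_sum => j; exact: subharmonic_disc_rot.
have [z0 z0s z0P] := subharmonic_disc_max s0 e3 sV.
have ns1 : normc (s1%:C : C) <= s by rewrite normc_real ger0_norm.
have := z0P _ ns1; have := nP _ ns1; have := nP z0; rewrite z0s lexx => /(_ isT).
(* The point [z0] is somewhere on the circle of radius [s]; a rotation, which preserves the mean,
   brings it to [s] itself. *)
have -> : mean (fun t => v (z0 * cis t)) = mean (fun t => v (s%:C * cis t)).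
  have [t0 _ z0E] := polar_decomposition z0; rewrite z0E z0s.
  have cs : continuous (fun t => v (s%:C * cis t)).
    have := @continuous_on_inner_circle s v 0 s s0 _ cv.
    rewrite ComplexField.Normc.normc0 subr0 lexx => /(_ isT).
    by under [in X in X -> _]eq_fun do rewrite add0r.
  rewrite -(mean_shift t0 cs); last by move=> t; rewrite cis2pi.
  by apply: eq_mean => t; rewrite cisD [cis t * _]mulrC mulrA.
by rewrite -/(V z0) -/(V s1%:C) !ler_norml; lra.
Qed.

(** The absolute value secures two-sided continuity at 0 and changes nothing on moduli, to which the
    lemma is applied. *)
Lemma continuous_norm_powR (q x : R) : 0 < q -> {for x, continuous (fun y : R => `|y| `^ q)}.
Proof.
move=> q0; have [->|x0] := eqVneq x 0.
  apply/cvgR_distP => e e0; rewrite normr0 powR0 ?gt_eqF //.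
  apply/nbhs_ballP; exists (e `^ q^-1); first by rewrite /= powR_gt0.
  move=> y; rewrite /ball /= sub0r normrN subr0 => ye.
  rewrite ger0_norm ?powR_ge0 // -[ltRHS](powRr1 (ltW e0)) -(mulVf (lt0r_neq0 q0)).
  by rewrite powRrM gt0_ltr_powR ?nnegrE ?powR_ge0.
have c1 : {for x, continuous (fun y : R => expR (q * ln `|y|))}.
  apply: (@continuous_comp _ _ _ (fun y : R => q * ln `|y|) expR); last exact: continuous_expR.
  apply: cvgM; first exact: cvg_cst.
  apply: (@continuous_comp _ _ _ (fun y : R => `|y|) (@ln R)); first exact: norm_continuous.
  by apply: continuous_ln; rewrite normr_gt0.
have E (y : R) : y != 0 -> `|y| `^ q = expR (q * ln `|y|).
  by move=> y0; rewrite /powR normr_eq0 (negbTE y0).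
rewrite /prop_for /continuous_at E //.
apply: cvg_trans c1; apply: near_eq_cvg.
have : \forall y \near x, y != 0 by exact: open_neq.
by apply: filterS => y /E.
Qed.

Lemma continuous_normc_powR (F : C -> C) z q : 0 < q -> {for z, continuous F} ->
  {for z, continuous (fun w => normc (F w) `^ q)}.
Proof.
move=> q0 cF.
have -> : (fun w => normc (F w) `^ q) = (fun w => `|normc (F w)| `^ q).
  by apply/funext => w; rewrite ger0_norm ?normc_ge0.
apply: (@continuous_comp _ _ _ (fun w => normc (F w)) (fun y : R => `|y| `^ q)).
  exact: cvg_normc.
exact: continuous_norm_powR.
Qed.

(* Near a point with [F z != 0] the function [ln |F| - ln |F z|] is the real part
   of [Log (F / F z)], hence harmonic, and [exp x >= 1 + x]. *)
Lemma sub_mean_normc_powR (F : C -> C) z q : 0 < q ->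
  (\forall w \near z, derivable F w 1) -> sub_mean_at (fun w => normc (F w) `^ q) z.
Proof.
move=> q0 /nbhsC_normcP[d d0 dP].
have cF w : normc (w - z) < d -> {for w, continuous F}.
  by move=> wd; apply: derivableC_continuous; exact: dP.
have cc r : 0 < r -> r < d -> continuous (fun t => normc (F (z + r%:C * cis t)) `^ q).
  move=> r0 rd; apply: (@continuous_on_circle _ _ (fun w => normc (F w) `^ q)); first exact: ltW.
  by move=> w wr; apply: continuous_normc_powR => //; apply: cF; lra.
have [Fz0|Fz] := eqVneq (F z) 0.
  exists d => // r r0 rd; rewrite Fz0 ComplexField.Normc.normc0 powR0 ?gt_eqF //.
  by apply: mean_ge0; [exact: cc|move=> t; exact: powR_ge0].
have nF : 0 < normc (F z) by rewrite normc_gt0.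
have cFz : {for z, continuous F} by apply: cF; rewrite subrr ComplexField.Normc.normc0.
pose Q w := F w / F z.
have cQ : {for z, continuous Q} by apply: cvgM; [exact: cFz|exact: cvg_cst].
have Qz : Q z = 1 by rewrite /Q divff.
have [d1 d10 d1P] : exists2 d1 : R, 0 < d1 & forall w, normc (w - z) < d1 -> 0 < Re (Q w).
  apply/nbhsC_normcP; have : 0 < Re (Q z) by rewrite Qz.
  by move=> /near_Re_gt0; exact: cQ.
exists (Num.min d d1); first by rewrite lt_min d0.
move=> r r0; rewrite lt_min => /andP[rd rd1].
have dG w : normc (w - z) <= r -> derivable (fun w => clog (Q w)) w 1.
  move=> wr; apply: derivableC_comp; last by apply: derivable_clog; apply: d1P; lra.
  apply: (@derivableM _ _ F (cst ((F z)^-1 : C))); last exact: derivable_cst.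
  by apply: dP; lra.
have := mean_value (ltW r0) dG.
rewrite Qz [Re (clog 1)]/= ComplexField.Normc.normc1 ln1 => G0.
have cG : continuous (fun t => Re (clog (Q (z + r%:C * cis t)))).
  move=> t; apply: cvg_Re; apply: (@continuous_on_circle _ _ (fun w => clog (Q w)) _ _ (ltW r0)).
  by move=> w wr; apply: derivableC_continuous; exact: dG.
have -> : normc (F z) `^ q = mean (fun t => normc (F z) `^ q *
    (1 + q * Re (clog (Q (z + r%:C * cis t))))).
  rewrite meanZ; last first.
    move=> t; apply: cvgD; first exact: cvg_cst.
    by apply: cvgM; [exact: cvg_cst|exact: cG].
  rewrite meanD; last 2 first.
  - by move=> t; exact: cvg_cst.
  - by move=> t; apply: cvgM; [exact: cvg_cst|exact: cG].
  by rewrite mean_cst meanZ // G0 mulr0 addr0 mulr1.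
apply: le_mean; last 2 first.
- exact: cc.
- move=> t; set w := z + _.
  have wr : normc (w - z) <= r by rewrite normc_circle // ltW.
  have w1 : 0 < Re (Q w) by apply: d1P; lra.
  have nQ := normc_gt0_Re w1.
  have -> : F w = F z * Q w by rewrite /Q mulrC divfK.
  rewrite ComplexField.Normc.normcM powRM ?normc_ge0 // ler_pM2l ?powR_gt0 //.
  by rewrite /powR gt_eqF //; exact: expR_ge1Dx.
move=> t; apply: cvgM; first exact: cvg_cst.
apply: cvgD; first exact: cvg_cst.
by apply: cvgM; [exact: cvg_cst|exact: cG].
Qed.

Lemma subharmonic_normc_powR (F : C -> C) s q : 0 < q -> s < 1 ->
  holomorphic_on_disc F -> subharmonic_disc s (fun w => normc (F w) `^ q).
Proof.
move=> q0 s1 hF; split=> z zs.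
  apply: continuous_normc_powR => //; apply: derivableC_continuous.
  by apply: hF; rewrite /in_disc; lra.
apply: sub_mean_normc_powR => //; apply/nbhsC_normcP.
exists (1 - normc z); first lra.
move=> w wz; apply: hF; rewrite /in_disc.
by have := normcD (w - z) z; rewrite subrK; lra.
Qed.

End Subharmonic.

(** * The [H^p] supremum through circle means *)

Section HardyMeans.
Variable R : realType.
Local Notation C := (R[i]^o).
Implicit Types (F : C -> C) (p r s : R).

Definition hmean p F r : R := mean (fun t => normc (F (r%:C * cis t)) `^ p).

(** This is [S F]. When the supremum is infinite, [fine] returns 0, so bounding a mean by [hsup]
    requires [in_Hp]. *)
Definition hsup p F : R := fine (hp_sup p F).

Lemma normc_polar r t : 0 <= r -> normc (r%:C * cis t) = r.
Proof.
by move=> r0; rewrite ComplexField.Normc.normcM normc_cis mulr1 normc_real ger0_norm.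
Qed.

Lemma continuous_on_circle0 (T : topologicalType) (f : C -> T) r : 0 <= r ->
  (forall w, normc w <= r -> {for w, continuous f}) ->
  continuous (fun t : R => f (r%:C * cis t)).
Proof.
move=> r0 cf.
have -> : (fun t : R => f (r%:C * cis t)) = (fun t : R => f (0 + r%:C * cis t)).
  by apply/funext => t; rewrite add0r.
by apply: continuous_on_circle => // w; rewrite subr0; exact: cf.
Qed.

Lemma holomorphic_continuous F z : holomorphic_on_disc F -> normc z < 1 ->
  {for z, continuous F}.
Proof. by move=> hF z1; apply: derivableC_continuous; exact: hF. Qed.

Lemma continuous_hmean p F r : 0 < p -> 0 <= r < 1 -> holomorphic_on_disc F ->
  continuous (fun t => normc (F (r%:C * cis t)) `^ p).
Proof.
move=> p0 /andP[r0 r1] hF.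
apply: (@continuous_on_circle0 _ (fun w => normc (F w) `^ p)) => // w wr.
apply: continuous_normc_powR => //; apply: holomorphic_continuous => //.
exact: le_lt_trans r1.
Qed.

Lemma hp_meanE p F r : 0 < p -> 0 <= r < 1 -> holomorphic_on_disc F ->
  hp_mean p F r = (hmean p F r)%:E.
Proof.
move=> p0 r01 hF; rewrite /hp_mean /hmean /mean EFinM; congr (_ * _)%E.
have cf := cont_segT (a := 0) (b := 2 * pi) (continuous_hmean p0 r01 hF).
have := cont_seg_integrable cf => /integrable_fin_num => fin.
rewrite /segint /Rintegral fineK //; exact: fin.
Qed.

Lemma hmean_ge0 p F r : 0 < p -> 0 <= r < 1 -> holomorphic_on_disc F -> 0 <= hmean p F r.
Proof.
move=> p0 r01 hF; apply: mean_ge0; first exact: continuous_hmean.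
by move=> t; exact: powR_ge0.
Qed.

Lemma hmean_mono p F r s : 0 < p -> 0 <= r -> r <= s -> s < 1 -> holomorphic_on_disc F ->
  hmean p F r <= hmean p F s.
Proof.
move=> p0 r0 rs s1 hF.
exact: (circle_mean_le r0 rs (subharmonic_normc_powR p0 s1 hF)).
Qed.

Lemma hp_sup_ge0 p F : 0 < p -> holomorphic_on_disc F -> (0 <= hp_sup p F)%E.
Proof.
move=> p0 hF; have h01 : 0 < (2^-1 : R) < 1 by lra.
have h01' : 0 <= (2^-1 : R) < 1 by lra.
apply: (@le_trans _ _ (hp_mean p F (2^-1))).
  by rewrite hp_meanE // lee_fin hmean_ge0.
by apply: ereal_sup_ubound; exists (2^-1).
Qed.

Lemma hp_supE p F : 0 < p -> in_Hp p F -> hp_sup p F = (hsup p F)%:E.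
Proof.
move=> p0 [hF fF]; rewrite /hsup fineK // ge0_fin_numE //.
exact: hp_sup_ge0.
Qed.

Lemma hsup_ge0 p F : 0 < p -> holomorphic_on_disc F -> 0 <= hsup p F.
Proof. by move=> p0 hF; rewrite /hsup fine_ge0 // hp_sup_ge0. Qed.

Lemma hmean_le_hsup p F r : 0 < p -> 0 < r < 1 -> in_Hp p F -> hmean p F r <= hsup p F.
Proof.
move=> p0 r01 iF; have [hF _] := iF.
rewrite -lee_fin -hp_supE // -hp_meanE //; last by case/andP: r01 => /ltW -> ->.
by apply: ereal_sup_ubound; exists r.
Qed.

Lemma hp_sup_le p F k : 0 < p -> holomorphic_on_disc F ->
  (forall r, 0 < r < 1 -> hmean p F r <= k) -> (hp_sup p F <= k%:E)%E.
Proof.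
move=> p0 hF Fk; apply: ge_ereal_sup => _ [r /= + <-]; rewrite in_itv /= => r01.
rewrite hp_meanE ?lee_fin ?Fk //; by case/andP: r01 => /ltW -> ->.
Qed.

Lemma in_Hp_bounded p F k : 0 < p -> holomorphic_on_disc F ->
  (forall r, 0 < r < 1 -> hmean p F r <= k) -> in_Hp p F.
Proof.
move=> p0 hF Fk; split => //; apply: le_lt_trans (hp_sup_le p0 hF Fk) _.
exact: ltry.
Qed.

Lemma hsup_le p F k : 0 < p -> holomorphic_on_disc F ->
  (forall r, 0 < r < 1 -> hmean p F r <= k) -> hsup p F <= k.
Proof.
move=> p0 hF Fk; rewrite -lee_fin -hp_supE //; first exact: hp_sup_le.
exact: in_Hp_bounded Fk.
Qed.

Lemma lt_hsup_hmean p F k : 0 < p -> in_Hp p F -> k < hsup p F ->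
  exists2 r, 0 < r < 1 & k < hmean p F r.
Proof.
move=> p0 iF kS; apply: contrapT => /forall2NP nr.
have [hF _] := iF.
have : hsup p F <= k.
  apply: hsup_le => // r r01; have [//|] := nr r.
  by move/negP; rewrite -leNgt.
by rewrite leNgt kS.
Qed.

Lemma hp_normE p F : hp_norm p F = hsup p F `^ p^-1.
Proof. by []. Qed.

End HardyMeans.

(** * The test functions and the Poisson kernel *)

Section TestFunctions.
Variable R : realType.
Local Notation C := (R[i]^o).
Implicit Types (p r : R) (w z : C).

Definition poisson w z : R := (1 - normc w ^+ 2) / normc (1 - w^* * z) ^+ 2.

Lemma normc_conj (z : R[i]) : normc z^* = normc z.
Proof. by case: z => a b; rewrite /ComplexField.Normc.normc /= sqrrN. Qed.

Lemma Re_1subM_gt0 (u v : C) : normc u < 1 -> normc v <= 1 -> 0 < Re (1 - u * v).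
Proof.
move=> u1 v1; rewrite raddfB /= subr_gt0.
apply: le_lt_trans (le_lt_trans (normc_Re _) _); first exact: ler_norm.
rewrite ComplexField.Normc.normcM; apply: le_lt_trans u1.
by rewrite ler_piMr ?normc_ge0.
Qed.

Lemma subr_normc_sqr_gt0 (u : C) : normc u < 1 -> 0 < 1 - normc u ^+ 2.
Proof. by move=> u1; rewrite subr_gt0 expr_lt1 // normc_ge0. Qed.

Lemma Re_cayley (z : C) : 0 < normc (1 - z) ->
  Re ((1 + z) / (1 - z)) = (1 - normc z ^+ 2) / normc (1 - z) ^+ 2.
Proof.
move=> n0; have : normc (1 - z) ^+ 2 != 0 by rewrite expf_neq0 // gt_eqF.
rewrite !normc_sqr; case: z {n0} => x y /= d0.
by field; move: d0; rewrite sub0r.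
Qed.

(** Mean value property for [(1 + u v) / (1 - u v)], holomorphic on the closed unit disc since
    [|u| < 1] and equal to 1 at 0; by [Re_cayley] its real part is a multiple of the integrand. *)
Lemma mean_poisson (u : C) : normc u < 1 ->
  mean (fun t => (normc (1 - u * cis t) ^+ 2)^-1) = (1 - normc u ^+ 2)^-1.
Proof.
move=> u1; have n0 := subr_normc_sqr_gt0 u1.
pose G (v : C) : C := (1 + u * v) / (1 - u * v).
have dG v : normc (v - 0) <= 1 -> derivable G v 1.
  rewrite subr0 => v1.
  have nz : 1 - u * v != 0 by rewrite -normc_gt0 normc_gt0_Re // Re_1subM_gt0.
  apply: (@derivableC_mul _ (fun v => 1 + u * v) (fun v => (1 - u * v)^-1)).
    exact: derivableC_affine.
  apply: (@derivableC_inv _ (fun v => 1 - u * v)); first exact: nz.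
  exact: derivableC_affineB.
have := mean_value ler01 dG.
have -> : (fun t => Re (G (0 + 1%:C * cis t))) =
    (fun t => (1 - normc u ^+ 2) * (normc (1 - u * cis t) ^+ 2)^-1).
  apply/funext => t; rewrite add0r mul1r.
  have c1 : normc (cis t : C) <= 1 by rewrite normc_cis.
  rewrite Re_cayley ?normc_gt0_Re ?Re_1subM_gt0 //.
  by rewrite ComplexField.Normc.normcM normc_cis mulr1.
have G0 : Re (G 0) = 1 by rewrite /G mulr0 addr0 subr0 divr1.
rewrite G0 meanZ; first by move=> H; apply: (mulfI (lt0r_neq0 n0)); rewrite H divff // gt_eqF.
move=> t; apply: cvgV.
  rewrite expf_neq0 // gt_eqF // normc_gt0_Re // Re_1subM_gt0 // normc_cis //.
apply: (@continuous_comp _ _ _ (fun t => 1 - u * cis t : C) (fun z : C => normc z ^+ 2)).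
  apply: cvgB; first exact: cvg_cst.
  by apply: cvgM; [exact: cvg_cst|exact: continuous_cis].
exact: continuous_normc_sqr.
Qed.

Lemma derivable_test_fn p w z : normc w < 1 -> normc z < 1 -> derivable (test_fn p w : C -> C) z 1.
Proof.
move=> w1 z1.
have Re0 : 0 < Re (1 - w^* * z) by rewrite Re_1subM_gt0 ?normc_conj // ltW.
apply: (@derivableC_mul _ (cst _)); first exact: derivable_cst.
apply: (@derivableC_inv _ (fun z => cpow_rhp (1 - w^* * z) (2 / p))).
  rewrite cpow_rhpE // -normc_gt0 normc_cexp; exact: expR_gt0.
apply: (@derivableC_comp _ (fun z => 1 - w^* * z) (fun u => cpow_rhp u (2 / p))).
  exact: derivableC_affineB.
exact: derivable_cpow_rhp.
Qed.

Lemma normc_test_fn p w z : 0 < p -> normc w < 1 -> normc z < 1 ->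
  normc (test_fn p w z) `^ p = poisson w z.
Proof.
move=> p0 w1 z1; have n0 := subr_normc_sqr_gt0 w1.
have Re0 : 0 < Re (1 - w^* * z) by rewrite Re_1subM_gt0 ?normc_conj // ltW.
have nz := normc_gt0_Re Re0.
rewrite /test_fn ComplexField.Normc.normcM ComplexField.Normc.normcV normc_real.
rewrite cpow_rhpE // normc_cexp /= !mul0r subr0.
have -> : expR (2 / p * ln (normc (1 - w^* * z))) = normc (1 - w^* * z) `^ (2 / p).
  by rewrite /powR gt_eqF.
rewrite ger0_norm ?powR_ge0 // powRM ?invr_ge0 ?powR_ge0 // -powRrM mulVf ?gt_eqF //.
rewrite powRr1 ?(ltW n0) // /poisson; congr (_ * _).
rewrite -[X in X `^ p](powR_inv1 (powR_ge0 _ _)) powRAC powR_inv1 ?powR_ge0 //; congr (_^-1).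
by rewrite -powRrM divfK ?gt_eqF // powR_mulrn // ltW.
Qed.

Lemma hmean_test_fn p w r : 0 < p -> normc w < 1 -> 0 <= r < 1 ->
  hmean p (test_fn p w) r = (1 - normc w ^+ 2) / (1 - (r * normc w) ^+ 2).
Proof.
move=> p0 w1 /andP[r0 r1].
pose u : C := w^* * r%:C.
have nu : normc u = r * normc w.
  by rewrite ComplexField.Normc.normcM normc_conj normc_real ger0_norm // mulrC.
have u1 : normc u < 1.
  rewrite nu; apply: le_lt_trans w1; rewrite ler_piMl ?normc_ge0 //; exact: ltW.
rewrite -nu -(mean_poisson u1) -meanZ.
  apply: eq_mean => t; rewrite normc_test_fn ?normc_polar //.
  by rewrite /poisson mulrA.
move=> t; apply: cvgV.
  rewrite expf_neq0 // gt_eqF // normc_gt0_Re // Re_1subM_gt0 // normc_cis //.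
apply: (@continuous_comp _ _ _ (fun t => 1 - u * cis t : C) (fun z : C => normc z ^+ 2)).
  apply: cvgB; first exact: cvg_cst.
  by apply: cvgM; [exact: cvg_cst|exact: continuous_cis].
exact: continuous_normc_sqr.
Qed.

Lemma holomorphic_test_fn p w : normc w < 1 -> holomorphic_on_disc (test_fn p w).
Proof. by move=> w1 z z1; exact: derivable_test_fn. Qed.

Lemma hmean_test_fn_le1 p w r : 0 < p -> normc w < 1 -> 0 < r < 1 ->
  hmean p (test_fn p w) r <= 1.
Proof.
move=> p0 w1 /andP[r0 r1]; rewrite hmean_test_fn //; last by rewrite r1 (ltW r0).
have rw : (r * normc w) ^+ 2 <= normc w ^+ 2.
  by rewrite exprMn ler_piMl ?sqr_ge0 // expr_le1 //; exact: ltW.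
have := subr_normc_sqr_gt0 w1 => w2.
rewrite ler_pdivrMr ?mul1r; lra.
Qed.

Lemma in_Hp_test_fn p w : 0 < p -> normc w < 1 -> in_Hp p (test_fn p w).
Proof.
move=> p0 w1; apply: (@in_Hp_bounded _ _ _ 1) => //; first exact: holomorphic_test_fn.
by move=> r r01; exact: hmean_test_fn_le1.
Qed.

(** One radius [r >= |w|] is enough: [1 - (r |w|)^2 <= 1 - |w|^4 <= 2 (1 - |w|^2)]. A bound uniform
    in [w] is all that the direct implication uses. *)
Lemma hsup_test_fn_ge p w : 0 < p -> normc w < 1 -> 2^-1 <= hsup p (test_fn p w).
Proof.
(* The maximum with 1/2 keeps [r] positive when [w = 0]. *)
move=> p0 w1; pose r := Num.max (normc w) 2^-1.
have r1 : r < 1 by rewrite gt_max w1; lra.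
have rw : normc w <= r by rewrite le_max lexx.
have r2 : 2^-1 <= r by rewrite le_max lexx orbT.
have r01 : 0 < r < 1 by rewrite r1 andbT; lra.
apply: le_trans (hmean_le_hsup p0 r01 (in_Hp_test_fn p0 w1)).
rewrite hmean_test_fn //; last lra.
have n0 := normc_ge0 w; set n := normc w in n0 w1 rw *.
have rn : n ^+ 2 <= r * n by rewrite expr2 ler_wpM2r.
have q0 : 0 <= n ^+ 2 by exact: sqr_ge0.
have q1 : n ^+ 2 < 1 by rewrite expr_lt1.
have rn1 : r * n < 1.
  apply: le_lt_trans r1; rewrite ler_piMr //; lra.
have rn2 : (n ^+ 2) ^+ 2 <= (r * n) ^+ 2.
  by rewrite ler_pXn2r // nnegrE; lra.
have rn3 : (r * n) ^+ 2 < 1 by rewrite expr_lt1 //; lra.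
rewrite ler_pdivlMr; nra.
Qed.

End TestFunctions.

(** * A convexity defect that controls [|a - b|^p] *)

Section Dilations.
Variable R : realType.
Local Notation C := (R[i]^o).
Implicit Types (F : C -> C) (p r s : R).

Lemma powR_midpoint p (x y : R) : 1 <= p -> 0 <= x -> 0 <= y ->
  ((x + y) / 2) `^ p <= (x `^ p + y `^ p) / 2.
Proof.
move=> p1 x0 y0.
have : (2^-1 * x + (1 - 2^-1) * y) `^ p <= 2^-1 * x `^ p + (1 - 2^-1) * y `^ p.
  by apply: (convex_powR p1 (Itv01 _ _)) => //=; rewrite ?inE /= ?in_itv /= ?x0 ?y0 //; lra.
have -> : 2^-1 * x + (1 - 2^-1) * y = (x + y) / 2 by field.
lra.
Qed.

Lemma powR_le_id p (x : R) : 1 <= p -> 0 <= x <= 1 -> x `^ p <= x.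
Proof.
move=> p1 /andP[]; rewrite le_eqVlt => /predU1P[<- _|x0 x1].
  by rewrite powR0 // gt_eqF //; lra.
by rewrite -[leRHS](powRr1 (ltW x0)) ger_powR // x0.
Qed.

Lemma powR_half_sqr p (x : R) : 0 < p -> 0 <= x -> x `^ p = (x `^ (p / 2)) ^+ 2.
Proof. by move=> p0 x0; rewrite -powR_mulrn ?powR_ge0 // -powRrM divfK. Qed.

(* The defect vanishes only for [a = b]: the first term forces [|a| = |b|] and the
   second one, by strict convexity of the Euclidean norm, [a = b]. *)
Definition mean_defect p (a b : C) : R :=
  (normc a `^ p + normc b `^ p) / 2 -
  (normc (a * b) `^ (p / 2) + normc ((a + b) / 2) `^ p) / 2.

Lemma normc_half_add (a b : C) : normc ((a + b) / 2) = normc (a + b) / 2.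
Proof.
rewrite ComplexField.Normc.normcM ComplexField.Normc.normcV.
have -> : (2 : R[i]) = (2 : R)%:C by rewrite rmorph_nat.
by rewrite normc_real ger0_norm.
Qed.

(** With [U = |a|^(p/2)] and [V = |b|^(p/2)], the defect is [(U - V)^2 / 4] plus half of the
    midpoint convexity gap of [|.|^p], and both are nonnegative. *)
Lemma mean_defect_ge0 p a b : 1 <= p -> 0 <= mean_defect p a b.
Proof.
move=> p1; have p0 : 0 < p by lra.
have := powR_midpoint p1 (normc_ge0 a) (normc_ge0 b).
have : normc ((a + b) / 2) `^ p <= ((normc a + normc b) / 2) `^ p.
  apply: ge0_ler_powR; rewrite ?nnegrE ?normc_ge0 //; first exact: ltW.
    by rewrite divr_ge0 // addr_ge0 // normc_ge0.
  by rewrite normc_half_add ler_pM2r ?invr_gt0 // normcD.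
rewrite /mean_defect (ComplexField.Normc.normcM a b) (powRM _ (normc_ge0 a) (normc_ge0 b)).
rewrite !(powR_half_sqr p0 (normc_ge0 a)) !(powR_half_sqr p0 (normc_ge0 b)).
set U := normc a `^ _; set V := normc b `^ _; set m := normc _ `^ p; set m' := _ `^ p.
have : 0 <= (U - V) ^+ 2 by exact: sqr_ge0.
rewrite sqrrB mulr2n; lra.
Qed.

Lemma parallelogram (a b : R[i]) :
  normc (a + b) ^+ 2 + normc (a - b) ^+ 2 = 2 * (normc a ^+ 2 + normc b ^+ 2).
Proof. by rewrite !normc_sqr; case: a => a1 a2; case: b => b1 b2 /=; ring. Qed.

Lemma mean_defectC p a b : mean_defect p a b = mean_defect p b a.
Proof.
by rewrite /mean_defect (addrC a) (mulrC a) [normc a `^ p + _]addrC.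
Qed.

(** One of the two nonnegative parts of the defect has to be large. The parallelogram law gives
    [|(a + b) / 2|^2 <= (1 - e^2 / 4) |a|^2], hence [|(a + b) / 2| <= (1 - k) |a|] with
    [k = e^2 / 8]. *)
Lemma mean_defect_far p (e : R) a b : 1 <= p -> 0 < e <= 1 -> normc b <= normc a ->
  e * normc a < normc (a - b) ->
  (e ^+ 2 / 8) ^+ 2 / 16 * normc a `^ p <= mean_defect p a b.
Proof.
move=> p1 /andP[e0 e1] ba ab; have p0 : 0 < p by lra.
have a0 := normc_ge0 a; have b0 := normc_ge0 b.
set k := e ^+ 2 / 8.
have k0 : 0 < k by rewrite divr_gt0 // exprn_gt0.
have k1 : k <= 1 / 8 by rewrite ler_pM2r ?invr_gt0 // expr_le1 // ltW.
have H1 : normc ((a + b) / 2) <= (1 - k) * normc a.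
  rewrite -(ler_pXn2r (n := 2)) ?nnegrE ?normc_ge0 //; last by rewrite mulr_ge0 //; lra.
  rewrite normc_half_add.
  have P := parallelogram a b.
  have A : (e * normc a) ^+ 2 <= normc (a - b) ^+ 2.
    by rewrite ler_pXn2r ?nnegrE ?normc_ge0 ?mulr_ge0 // ltW.
  have B : normc b ^+ 2 <= normc a ^+ 2 by rewrite ler_pXn2r ?nnegrE.
  have K : 0 <= k ^+ 2 * normc a ^+ 2 by rewrite mulr_ge0 ?sqr_ge0.
  have E8 : e ^+ 2 = 8 * k by rewrite /k; field.
  move: A; rewrite exprMn E8 => A.
  rewrite expr_div_n !exprMn; lra.
have H2 : normc ((a + b) / 2) `^ p <= (1 - k) * normc a `^ p.
  apply: (@le_trans _ _ (((1 - k) * normc a) `^ p)).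
    apply: ge0_ler_powR; rewrite ?nnegrE ?normc_ge0 //; first exact: ltW.
    by rewrite mulr_ge0 //; lra.
  rewrite powRM //; last lra.
  by rewrite ler_wpM2r ?powR_ge0 // powR_le_id //; lra.
have H3 : normc ((a + b) / 2) `^ p <= (normc a `^ p + normc b `^ p) / 2.
  apply: le_trans (powR_midpoint p1 a0 b0).
  apply: ge0_ler_powR; rewrite ?nnegrE ?normc_ge0 //; first exact: ltW.
    by rewrite divr_ge0 // addr_ge0.
  by rewrite normc_half_add ler_pM2r ?invr_gt0 // normcD.
rewrite /mean_defect (ComplexField.Normc.normcM a b) (powRM _ a0 b0).
move: H2 H3; rewrite !(powR_half_sqr p0 a0) !(powR_half_sqr p0 b0).
have VU : normc b `^ (p / 2) <= normc a `^ (p / 2).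
  by apply: ge0_ler_powR; rewrite ?nnegrE ?normc_ge0 //; lra.
set m := normc _ `^ p; move: VU (powR_ge0 (normc a) (p / 2)) (powR_ge0 (normc b) (p / 2)).
set U := normc a `^ _; set V := normc b `^ _ => VU U0 V0 H2 H3.
(* If [|b|^p] is at least [(1 - k) |a|^p], the midpoint gap alone yields [k U^2 / 4]. Otherwise
   [U - V >= k U / 2] and the square yields [k^2 U^2 / 16], the smaller bound. *)
have [far|near] := leP ((1 - k) * U ^+ 2) (V ^+ 2).
  have UV : 0 <= (U - V) ^+ 2 by exact: sqr_ge0.
  have U2 : 0 <= U ^+ 2 by exact: sqr_ge0.
  have kk : k ^+ 2 <= k * (1 / 8) by rewrite expr2 ler_pM2l.
  have : k ^+ 2 * U ^+ 2 <= k * (1 / 8) * U ^+ 2 by rewrite ler_wpM2r.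
  have : 0 <= k * U ^+ 2 by rewrite mulr_ge0 // ltW.
  move: UV; rewrite sqrrB mulr2n; lra.
have D : k * U / 2 <= U - V.
  have [U00|Une] := eqVneq U 0; first by rewrite U00 mulr0 mul0r; lra.
  have Up : 0 < U by rewrite lt_neqAle eq_sym Une.
  rewrite -(ler_pM2l Up); nra.
have : (k * U / 2) ^+ 2 <= (U - V) ^+ 2.
  by rewrite ler_pXn2r // nnegrE ?subr_ge0 // divr_ge0 ?mulr_ge0 // ltW.
have -> : (k * U / 2) ^+ 2 = k ^+ 2 * U ^+ 2 / 4 by field.
have -> : (U - V) ^+ 2 = U ^+ 2 - 2 * (U * V) + V ^+ 2 by ring.
lra.
Qed.

(** Either [|a - b| <= d |a|] for the larger modulus [|a|], and the first term suffices, or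
    [mean_defect_far] bounds [|a|^p], hence [|a - b|^p <= 2^p |a|^p], by the defect. *)
Lemma powR_normcB_le p (e : R) : 1 <= p -> 0 < e -> exists2 K : R, 0 < K &
  forall a b : C, normc (a - b) `^ p <=
    e * (normc a `^ p + normc b `^ p) + K * mean_defect p a b.
Proof.
move=> p1 e0; have p0 : 0 < p by lra.
(* Capped at 1 to meet the hypothesis of [mean_defect_far] and to have [d^p <= d <= e]. *)
pose d := Num.min 1 e.
have d0 : 0 < d by rewrite lt_min ltr01.
have d1 : d <= 1 by rewrite ge_min lexx.
have de : d <= e by rewrite ge_min lexx orbT.
pose k := (d ^+ 2 / 8) ^+ 2 / 16; have k0 : 0 < k by rewrite !(divr_gt0, exprn_gt0).
pose K := 2 `^ p / k; have K0 : 0 < K by rewrite divr_gt0 // powR_gt0.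
exists K => //.
suff main a b : normc b <= normc a -> normc (a - b) `^ p <=
    e * (normc a `^ p + normc b `^ p) + K * mean_defect p a b.
  move=> a b; have [ba|ab] := leP (normc b) (normc a); first exact: main.
  by rewrite normcB mean_defectC [normc a `^ p + _]addrC main // ltW.
move=> ba; have a0 := normc_ge0 a; have b0 := normc_ge0 b.
have D0 := mean_defect_ge0 a b p1.
have [near|far] := leP (normc (a - b)) (d * normc a).
  have : normc (a - b) `^ p <= e * normc a `^ p.
    apply: (@le_trans _ _ ((d * normc a) `^ p)).
      apply: ge0_ler_powR; rewrite ?nnegrE ?normc_ge0 //; first exact: ltW.
      by rewrite mulr_ge0 // ltW.
    rewrite powRM // ?ler_wpM2r ?powR_ge0 //; last exact: ltW.
    by apply: le_trans de; apply: powR_le_id => //; rewrite d1 ltW.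
  have : 0 <= K * mean_defect p a b by rewrite mulr_ge0 // ltW.
  have : 0 <= e * normc b `^ p by rewrite mulr_ge0 ?powR_ge0 // ltW.
  lra.
have := mean_defect_far p1 (e := d) (a := a) (b := b); rewrite d0 d1 => /(_ isT ba far).
rewrite -/k => H.
have A : normc (a - b) `^ p <= 2 `^ p * normc a `^ p.
  rewrite -powRM //; apply: ge0_ler_powR; rewrite ?nnegrE ?normc_ge0 ?mulr_ge0 //.
    exact: ltW.
  by have := normcD a (- b); rewrite normcN; lra.
have B : 2 `^ p * normc a `^ p <= K * mean_defect p a b.
  by rewrite /K -mulrA ler_pM2l ?powR_gt0 // ler_pdivlMl.
have : 0 <= e * (normc a `^ p + normc b `^ p).
  by rewrite mulr_ge0 ?addr_ge0 ?powR_ge0 // ltW.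
lra.
Qed.

End Dilations.

(** * Dilates on a fixed closed disc *)

Section DilationConvergence.
Variable R : realType.
Local Notation C := (R[i]^o).
Implicit Types (F G : C -> C) (p r s : R).

Lemma holomorphic_add F G : holomorphic_on_disc F -> holomorphic_on_disc G ->
  holomorphic_on_disc (fun z => F z + G z).
Proof. by move=> hF hG z z1; apply: derivableC_add; [exact: hF|exact: hG]. Qed.

Lemma holomorphic_mul F G : holomorphic_on_disc F -> holomorphic_on_disc G ->
  holomorphic_on_disc (fun z => F z * G z).
Proof. by move=> hF hG z z1; apply: derivableC_mul; [exact: hF|exact: hG]. Qed.

Lemma holomorphic_cst (k : C) : holomorphic_on_disc (fun=> k).
Proof. by move=> z z1; exact: derivable_cst. Qed.

Lemma holomorphic_sub F G : holomorphic_on_disc F -> holomorphic_on_disc G ->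
  holomorphic_on_disc (fun z => F z - G z).
Proof.
move=> hF hG z z1; exact: (@derivableB _ _ _ F G _ _ (hF z z1) (hG z z1)).
Qed.

Definition dilate (d : R) F (z : C) : C := F (d%:C * z).

Lemma normc_scale (d : R) (z : C) : 0 <= d -> normc (d%:C * z) = d * normc z.
Proof. by move=> d0; rewrite ComplexField.Normc.normcM normc_real ger0_norm. Qed.

Lemma derivable_dilate d F z : derivable F (d%:C * z) 1 -> derivable (dilate d F) z 1.
Proof.
move=> dF; apply: (@derivableC_comp _ (fun w => d%:C * w) F); last exact: dF.
by apply: derivableC_mul; [exact: derivable_cst|exact: derivable_id].
Qed.

Lemma holomorphic_dilate d F : 0 <= d <= 1 -> holomorphic_on_disc F ->
  holomorphic_on_disc (dilate d F).
Proof.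
move=> /andP[d0 d1] hF z z1; apply: derivable_dilate; apply: hF.
rewrite /in_disc normc_scale //; apply: le_lt_trans z1.
by rewrite ler_piMl // normc_ge0.
Qed.

Lemma hmean_dilate p d F s : hmean p (dilate d F) s = hmean p F (d * s).
Proof. by apply: eq_mean => t; rewrite /dilate mulrA -rmorphM. Qed.

Lemma hmean_dilate_le p d F s : 0 < p -> 0 < d <= 1 -> 0 < s < 1 -> in_Hp p F ->
  hmean p (dilate d F) s <= hsup p F.
Proof.
move=> p0 /andP[d0 d1] /andP[s0 s1] iF; rewrite hmean_dilate hmean_le_hsup //.
by rewrite mulr_gt0 //=; apply: le_lt_trans s1; rewrite ler_piMl // ltW.
Qed.

Lemma in_Hp_dilate p d F : 0 < p -> 0 < d <= 1 -> in_Hp p F -> in_Hp p (dilate d F).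
Proof.
move=> p0 d01 iF; have [hF _] := iF.
have d01' : 0 <= d <= 1 by case/andP: d01 => /ltW ->.
apply: (@in_Hp_bounded _ _ _ (hsup p F) p0 (holomorphic_dilate d01' hF)).
by move=> r r01; exact: hmean_dilate_le.
Qed.

Lemma cvg_normc_powR (T : Type) (A : set_system T) (FA : Filter A) (f : T -> C) (l : C) q :
  0 < q -> f @ A --> l -> normc (f x) `^ q @[x --> A] --> normc l `^ q.
Proof.
move=> q0 fl.
have -> : (fun x => normc (f x) `^ q) = (fun y => `|y| `^ q) \o (fun x => normc (f x)).
  by apply/funext => x /=; rewrite ger0_norm ?normc_ge0.
rewrite -[normc l]ger0_norm ?normc_ge0 //.
apply: (@cvg_comp _ _ _ (fun x => normc (f x)) (fun y : R => `|y| `^ q) A (nbhs (normc l))).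
  exact: cvg_normc.
exact: continuous_norm_powR.
Qed.

(** For [d = 1] both terms subtracted in the defect are [|F w|^p]. The neighbourhood is joint in [w]
    and [d] because [dilate_near] feeds it to a compactness argument in [w]. *)
Lemma near_dilate_mean p F (z : C) (e : R) : 0 < p -> 0 < e -> {for z, continuous F} ->
  \forall w \near z & d \near (1 : R), normc (F w) `^ p - e <=
    (normc (dilate d F w * F w) `^ (p / 2) + normc ((dilate d F w + F w) / 2) `^ p) / 2.
Proof.
move=> p0 e0 cF.
have FF : Filter (filter_prod (nbhs z) (nbhs (1 : R))) by exact: filter_prod_filter.
set A := filter_prod _ _ in FF *.
have c0 : (q.2%:C : C) @[q --> A] --> (1%:C : C).
  by apply: cvg_real_complex; exact: cvg_snd.
have c1 : (q.1 : C) @[q --> A] --> z by exact: cvg_fst.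
have cq : (q.2%:C * q.1 : C) @[q --> A] --> z.
  have E : (1%:C : C) * z = z by rewrite rmorph1 mul1r.
  by have := cvgM c0 c1; rewrite E => K; exact: K.
have ca : (dilate q.2 F q.1 : C) @[q --> A] --> F z.
  exact: (@cvg_comp _ _ _ (fun q : C * R => q.2%:C * q.1 : C) F A (nbhs z) _ cq cF).
have cb : (F q.1 : C) @[q --> A] --> F z.
  exact: (@cvg_comp _ _ _ (fun q : C * R => q.1) F A (nbhs z) _ c1 cF).
have p20 : 0 < p / 2 by rewrite divr_gt0.
have k1 := cvg_normc_powR FF p20 (cvgM ca cb).
have k2 := cvg_normc_powR FF p0 (cvgM (cvgD ca cb) (cvg_cst (2^-1 : C))).
have k3 := cvg_normc_powR FF p0 cb.
have := cvgB (cvgM (cvgD (k1 FF) (k2 FF FF FF)) (cvg_cst (2^-1 : R))) k3.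
have -> : (normc (F z * F z) `^ (p / 2) + normc ((F z + F z) / 2) `^ p) * 2^-1 -
    normc (F z) `^ p = 0.
  have -> : (F z + F z) / 2 = F z by rewrite -mulr2n -[F z *+ 2]mulr_natr mulfK // pnatr_eq0.
  rewrite ComplexField.Normc.normcM powRM ?normc_ge0 // (powR_half_sqr p0 (normc_ge0 _)).
  by rewrite expr2; field.
move=> /(_ FF FF FF FF) /cvgR_distP /(_ _ e0); apply: filterS => q H.
have {H} : `|(normc (dilate q.2 F q.1 * F q.1) `^ (p / 2) +
    normc ((dilate q.2 F q.1 + F q.1) / 2) `^ p) * 2^-1 - normc (F q.1) `^ p - 0| < e.
  exact: H.
rewrite subr0 ltr_norml => /andP[+ _]; rewrite /=; lra.
Qed.

Lemma dilate_near p F s (e : R) : 0 < p -> 0 < e -> s < 1 -> holomorphic_on_disc F ->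
  exists2 d0 : R, d0 < 1 & forall d, d0 < d -> d < 1 -> forall z : C, normc z <= s ->
    normc (F z) `^ p - e <=
    (normc (dilate d F z * F z) `^ (p / 2) + normc ((dilate d F z + F z) / 2) `^ p) / 2.
Proof.
move=> p0 e0 s1 hF.
pose P (d : R) (z : C) := normc (F z) `^ p - e <=
  (normc (dilate d F z * F z) `^ (p / 2) + normc ((dilate d F z + F z) / 2) `^ p) / 2.
have /nbhs_ballP[r /= r0 rP] : \forall d \near (1 : R), closed_disc s `<=` P d.
  have /compact_near_coveringP ncov := @compact_closed_disc R s.
  apply: (ncov R (nbhs (1 : R)) P) => z zs.
  apply: near_dilate_mean => //; apply: holomorphic_continuous; first exact: hF.
  exact: le_lt_trans zs s1.
exists (1 - r); first lra.
move=> d d0 d1 z zs; apply: (rP d) => //.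
by rewrite /ball /= ger0_norm; lra.
Qed.

End DilationConvergence.

(** * Convergence of the dilates in [H^p] *)

Section DilationNorm.
Variable R : realType.
Local Notation C := (R[i]^o).
Implicit Types (F G : C -> C) (p r s : R).

Lemma continuousZD (k l : R) (f g : R -> R) : continuous f -> continuous g ->
  continuous (fun t => k * f t + l * g t).
Proof.
by move=> cf cg t; apply: cvgD; apply: cvgM; [exact: cvg_cst|exact: cf|exact: cvg_cst|exact: cg].
Qed.

Lemma meanZD (k l : R) (f g : R -> R) : continuous f -> continuous g ->
  mean (fun t => k * f t + l * g t) = k * mean f + l * mean g.
Proof.
have cZ (a : R) (u : R -> R) : continuous u -> continuous (fun t => a * u t).
  by move=> cu t; apply: cvgM; [exact: cvg_cst|exact: cu].
by move=> cf cg; rewrite meanD ?meanZ //; exact: cZ.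
Qed.

(** Pick [s0] where the mean of [|F|^p] exceeds [S - tau]. For [d] near 1 the subtracted terms
    average at least [S - 2 tau] on that circle, hence on all larger ones by monotonicity, while
    [|F|^p] and the dilate have means at most [S]. The mean defect is thus at most [2 tau],
    uniformly in [s >= s0]. *)
Theorem dilate_cvg p F (e : R) : 1 <= p -> in_Hp p F -> 0 < e ->
  exists2 d0 : R, 0 <= d0 < 1 & forall d, d0 < d -> d < 1 -> forall s, 0 < s < 1 ->
    hmean p (fun z => dilate d F z - F z) s <= e.
Proof.
move=> p1 iF e0; have p0 : 0 < p by lra.
have [hF _] := iF; have S0 := hsup_ge0 p0 hF; set S := hsup p F in S0.
have S1 : 0 < S + 1 by lra.
(* The final estimate is [2 e1 S + 2 K tau], at most [e / 2 + e / 4]; [S + 1] replaces [S], which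
   may be 0. *)
pose e1 := e / (4 * (S + 1)).
have e10 : 0 < e1 by rewrite divr_gt0 // mulr_gt0.
have [K K0 KP] := powR_normcB_le p1 e10.
pose tau := e / (8 * K); have tau0 : 0 < tau by rewrite divr_gt0 // mulr_gt0.
have e1S : e1 * S <= e / 4.
  rewrite /e1 mulrAC ler_pdivrMr ?mulr_gt0 //.
  have -> : e / 4 * (4 * (S + 1)) = e * (S + 1) by field.
  by rewrite ler_pM2l //; lra.
have Ktau : K * tau = e / 8 by rewrite /tau; field; rewrite gt_eqF.
have k0 : 0 < e1 + K / 2 by rewrite addr_gt0 // divr_gt0.
have i20 : 0 <= 2^-1 :> R by rewrite invr_ge0.
have [|s0 s001 s0S] := @lt_hsup_hmean R p F (S - tau) p0 iF; first by rewrite -/S; lra.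
have [s00 s01] := andP s001.
have [d1 d11 d1P] := dilate_near p0 tau0 s01 hF.
exists (Num.max d1 0); first by rewrite le_max lexx orbT gt_max d11 ltr01.
move=> d; rewrite gt_max => /andP[d1d d0] d1' .
have d01 : 0 < d <= 1 by rewrite d0 ltW.
have d01' : 0 <= d <= 1 by rewrite !ltW.
have hA := holomorphic_dilate d01' hF.
have hAF := holomorphic_mul hA hF.
have hAF2 := holomorphic_mul (holomorphic_add hA hF) (@holomorphic_cst R (2^-1)).
have hB := holomorphic_sub hA hF.
have p20 : 0 < p / 2 by rewrite divr_gt0.
pose h1 s := hmean (p / 2) (fun z => dilate d F z * F z) s.
pose h2 s := hmean p (fun z => (dilate d F z + F z) / 2) s.
have s001' : 0 <= s0 < 1 by rewrite ltW.
have H0 : S - 2 * tau <= 2^-1 * h1 s0 + 2^-1 * h2 s0.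
  rewrite -meanZD; last 2 first.
  - exact: (continuous_hmean p20 s001' hAF).
  - exact: (continuous_hmean p0 s001' hAF2).
  have : mean (fun t => 1 * normc (F (s0%:C * cis t)) `^ p + (-1) * tau) <=
      mean (fun t => 2^-1 * normc (dilate d F (s0%:C * cis t) * F (s0%:C * cis t)) `^ (p / 2) +
        2^-1 * normc ((dilate d F (s0%:C * cis t) + F (s0%:C * cis t)) / 2) `^ p).
    apply: le_mean.
    - apply: (@continuousZD 1 (-1) _ (fun=> tau)); first exact: (continuous_hmean p0 s001' hF).
      by move=> t; exact: cvg_cst.
    - apply: continuousZD; first exact: (continuous_hmean p20 s001' hAF).
      exact: (continuous_hmean p0 s001' hAF2).
    - move=> t; have := d1P d d1d d1' (s0%:C * cis t).
      by rewrite normc_polar ?(ltW s00) // lexx => /(_ isT); lra.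
  rewrite (@meanZD 1 (-1) _ (fun=> tau)); last 2 first.
  - exact: (continuous_hmean p0 s001' hF).
  - by move=> t; exact: cvg_cst.
  rewrite mean_cst; move: s0S; rewrite /hmean; lra.
have main s : s0 <= s -> s < 1 -> hmean p (fun z => dilate d F z - F z) s <= e.
  move=> s0s s1; have s01'' : 0 < s < 1 by rewrite s1 (lt_le_trans s00).
  have s01w : 0 <= s < 1 by rewrite s1 (le_trans (ltW s00)).
  have cA := continuous_hmean p0 s01w hA.
  have cF := continuous_hmean p0 s01w hF.
  have c1 := continuous_hmean p20 s01w hAF.
  have c2 := continuous_hmean p0 s01w hAF2.
  have cs := @continuousZD (e1 + K / 2) (e1 + K / 2) _ _ cA cF.
  have cd := @continuousZD (K / 2) (K / 2) _ _ c1 c2.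
  apply: (@le_trans _ _ (mean (fun t => 1 *
      ((e1 + K / 2) * normc (dilate d F (s%:C * cis t)) `^ p +
       (e1 + K / 2) * normc (F (s%:C * cis t)) `^ p) + (-1) *
      (K / 2 * normc (dilate d F (s%:C * cis t) * F (s%:C * cis t)) `^ (p / 2) +
       K / 2 * normc ((dilate d F (s%:C * cis t) + F (s%:C * cis t)) / 2) `^ p)))).
    apply: le_mean.
    - exact: (continuous_hmean p0 s01w hB).
    - exact: (@continuousZD 1 (-1) _ _ cs cd).
    - move=> t; apply: le_trans (KP _ _) _; rewrite /mean_defect; lra.
  rewrite (meanZD 1 (-1) cs cd) (meanZD _ _ cA cF) (meanZD _ _ c1 c2).
  have A1 : hmean p (dilate d F) s <= S by exact: hmean_dilate_le.
  have A2 : hmean p F s <= S by exact: hmean_le_hsup.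
  have B1 : h1 s0 <= h1 s by exact: (hmean_mono p20 (ltW s00) s0s s1 hAF).
  have B2 : h2 s0 <= h2 s by exact: (hmean_mono p0 (ltW s00) s0s s1 hAF2).
  rewrite -/(hmean p (dilate d F) s) -/(hmean p F s).
  have E1 : mean (fun t => normc (dilate d F (s%:C * cis t) * F (s%:C * cis t)) `^ (p / 2)) =
    h1 s by exact: erefl.
  have E2 : mean (fun t => normc ((dilate d F (s%:C * cis t) + F (s%:C * cis t)) / 2) `^ p) =
    h2 s by exact: erefl.
  rewrite E1 E2.
  have L1 := ler_wpM2l (ltW k0) A1; have L2 := ler_wpM2l (ltW k0) A2.
  have B12 : 2^-1 * h1 s0 + 2^-1 * h2 s0 <= 2^-1 * h1 s + 2^-1 * h2 s.
    by apply: lerD; apply: ler_wpM2l; [exact: i20|exact: B1|exact: i20|exact: B2].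
  have L3 := ler_wpM2l (ltW K0) (le_trans H0 B12).
  move: e0 L1 L2 L3 e1S Ktau; clear.
  move: (hmean p (dilate d F) s) (hmean p F s) (h1 s) (h2 s) => x1 x2 x3 x4; lra.
(* Below [s0] the difference itself is holomorphic, so its means are bounded by the one at [s0]. *)
move=> s /andP[ss0 ss1]; have [s0s|ss0'] := leP s0 s; first exact: main.
apply: le_trans (main s0 (lexx _) s01).
exact: (hmean_mono p0 (ltW ss0) (ltW ss0') s01 hB).
Qed.

End DilationNorm.

(** * Lower bound for functions continuous on the closed disc *)

Section LowerBound.
Variable R : realType.
Local Notation C := (R[i]^o).
Implicit Types (F : C -> C) (p r s : R) (w z : C).

Lemma pseudohyperbolic w z : normc (1 - w^* * z) ^+ 2 - normc (w - z) ^+ 2 =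
  (1 - normc w ^+ 2) * (1 - normc z ^+ 2).
Proof. by rewrite !normc_sqr; case: w => w1 w2; case: z => z1 z2 /=; ring. Qed.

Lemma poisson_ge0 w z : normc w < 1 -> 0 <= poisson w z.
Proof. by move=> w1; rewrite divr_ge0 ?sqr_ge0 // ltW // subr_normc_sqr_gt0. Qed.

Lemma dist_poisson_le w z : normc w < 1 -> normc z < 1 ->
  normc (w - z) ^+ 2 * poisson w z <= 1 - normc w ^+ 2.
Proof.
move=> w1 z1; have w0 := subr_normc_sqr_gt0 w1; have z0 := subr_normc_sqr_gt0 z1.
have n0 : 0 < normc (1 - w^* * z) ^+ 2.
  by rewrite exprn_gt0 // normc_gt0_Re // Re_1subM_gt0 ?normc_conj // ltW.
have H := pseudohyperbolic w z; have : 0 < (1 - normc w ^+ 2) * (1 - normc z ^+ 2).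
  exact: mulr_gt0.
rewrite -H subr_gt0 => D.
rewrite /poisson mulrCA ger_pMr //.
by rewrite ler_pdivrMr // mul1r ltW.
Qed.

(** As a function of [t] the kernel is [Q (u * cis t)] with [u] the conjugate of [z] scaled by [r].
    Its mean is [(1 - r^2) / (1 - |u|^2) <= 1], and the Riemann error adds at most 1. Since
    [|u| <= r], a compact disc covers all [z] and the rank is uniform. *)
Lemma poisson_sum_le r : 0 < r < 1 -> exists n0 : nat, forall n, (n0 <= n)%N ->
  forall z, normc z < 1 -> riemann_sum (fun t => poisson (r%:C * cis t) z) n <= 2.
Proof.
move=> /andP[r0 r1].
pose Q (u : C) := (1 - r ^+ 2) / normc (1 - u) ^+ 2.
have nQ (u : C) : normc u < 1 -> 0 < normc (1 - u).
  move=> u1; have := Re_1subM_gt0 u1 (v := 1).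
  by rewrite mulr1 ComplexField.Normc.normc1 lexx => /(_ isT) /normc_gt0_Re.
have cQ u : normc u <= r -> {for u, continuous Q}.
  move=> ur; apply: cvgM; first exact: cvg_cst.
  apply: cvgV; first by rewrite expf_neq0 // gt_eqF // nQ //; exact: le_lt_trans r1.
  apply: (@continuous_comp _ _ _ (fun u : C => 1 - u : C) (fun z : C => normc z ^+ 2)).
    by apply: cvgB; [exact: cvg_cst|exact: cvg_id].
  exact: continuous_normc_sqr.
have [n0 n0P] := riemann_sum_circle ltr01 cQ.
exists n0 => n nn z z1.
pose u : C := r%:C * z^*.
have nu : normc u = r * normc z by rewrite normc_scale ?normc_conj // ltW.
have ur : normc u <= r by rewrite nu ler_piMr // ltW.
have u1 : normc u < 1 by exact: le_lt_trans r1.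
have pE t : poisson (r%:C * cis t) z = Q (u * cis t).
  rewrite /poisson /Q normc_polar ?(ltW r0) //; congr (_ / _ ^+ 2).
  rewrite -[RHS]normc_conj; congr normc.
  by rewrite /u rmorphB rmorph1 !rmorphM /= conjcK; congr (_ - _); rewrite mulrAC.
have -> : riemann_sum (fun t => poisson (r%:C * cis t) z) n =
    riemann_sum (fun t => Q (u * cis t)) n.
  by congr (_ * _); apply: eq_bigr => j _; exact: pE.
have := n0P n nn u ur.
have -> : mean (fun t => Q (u * cis t)) = (1 - r ^+ 2) * (1 - normc u ^+ 2)^-1.
  rewrite -(mean_poisson u1) -meanZ //.
  move=> t; apply: cvgV; first by rewrite expf_neq0 // gt_eqF // nQ // ComplexField.Normc.normcM normc_cis mulr1.
  apply: (@continuous_comp _ _ _ (fun t => 1 - u * cis t : C) (fun z : C => normc z ^+ 2)).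
    apply: cvgB; first exact: cvg_cst.
    by apply: cvgM; [exact: cvg_cst|exact: continuous_cis].
  exact: continuous_normc_sqr.
have : (1 - r ^+ 2) * (1 - normc u ^+ 2)^-1 <= 1.
  rewrite ler_pdivrMr ?subr_normc_sqr_gt0 // mul1r.
  by rewrite lerD2l lerN2 ler_pXn2r ?nnegrE ?normc_ge0 // ltW.
rewrite ler_norml; lra.
Qed.

(* Uniform continuity, with the large distances absorbed in the quadratic term. *)
Lemma quadratic_modulus (g : C -> R) (e : R) : 0 < e -> (forall z, 0 <= g z) ->
  (forall z, normc z <= 1 -> {for z, continuous g}) ->
  exists2 K : R, 0 <= K & forall w z, normc w <= 1 -> normc z <= 1 ->
    g w <= g z + e + K * normc (w - z) ^+ 2.
Proof.
move=> e0 g0 cg.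
have [d d0 dP] := disc_unif_continuousR e0 cg.
have [z0 _ z0P] := disc_EVT_max ler01 cg.
have K0 : 0 <= g z0 / d ^+ 2 by rewrite divr_ge0 // sqr_ge0.
exists (g z0 / d ^+ 2) => // w z w1 z1.
have q0 : 0 <= g z0 / d ^+ 2 * normc (w - z) ^+ 2 by rewrite mulr_ge0 // sqr_ge0.
have [far|near] := leP d (normc (w - z)).
  have : g z0 <= g z0 / d ^+ 2 * normc (w - z) ^+ 2.
    rewrite mulrAC ler_pdivlMr ?exprn_gt0 // ler_wpM2l //.
    by rewrite ler_pXn2r ?nnegrE ?normc_ge0 // ltW.
  by have := z0P w w1; have := g0 z; lra.
by have := dP z w z1 near; rewrite ltr_norml; lra.
Qed.

(** Provides one circle on which all the finitely many [W l_w] have large mean; monotonicity of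
    circle means makes the largest radius work. *)
Lemma common_radius (P : nat -> R -> Prop) (n : nat) :
  (forall j s s', 0 < s -> s <= s' -> s' < 1 -> P j s -> P j s') ->
  (forall j, exists2 s, 0 < s < 1 & P j s) ->
  exists2 s, 0 < s < 1 & forall j, (j < n)%N -> P j s.
Proof.
move=> mP eP; elim: n => [|n [s /andP[s0 s1] IH]].
  by exists 2^-1 => //; lra.
have [s' /andP[s'0 s'1] Ps'] := eP n.
have m1 : Num.max s s' < 1 by rewrite gt_max s1.
exists (Num.max s s'); first by rewrite lt_max s0 m1.
move=> j; rewrite ltnS leq_eqVlt => /predU1P[->|jn].
  by apply: (mP n s') => //; rewrite le_max lexx orbT.
by apply: (mP j s) => //; [rewrite le_max lexx|exact: IH].
Qed.

(** The weighted Poisson average is bounded at every point of the disc, so composing with [psi]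
    costs nothing: the bound is read at [z = psi zeta] and multiplied by [|h zeta|^p]. *)
Theorem hsup_wcomp_ge p (h psi F : C -> C) (c : R) : 0 < p -> 0 < c ->
  in_Hp p h -> holomorphic_on_disc psi -> (forall z, in_disc z -> in_disc (psi z)) ->
  (forall f, in_Hp p f -> in_Hp p (wcomp h psi f)) ->
  (forall w, in_disc w -> c <= hsup p (wcomp h psi (test_fn p w))) ->
  in_Hp p F -> (forall z, normc z <= 1 -> {for z, continuous F}) ->
  c / 2 * hsup p F <= 2 * hsup p (wcomp h psi F).
Proof.
move=> p0 c0 ih hpsi dpsi iW cW iF cF.
have [hh _] := ih; have [hF _] := iF.
have iWF := iW F iF.
have hWF : holomorphic_on_disc (wcomp h psi F) := iWF.1.
set SW := hsup p (wcomp h psi F); set Sh := hsup p h.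
have Sh0 : 0 <= Sh := hsup_ge0 p0 hh.
pose g z := normc (F z) `^ p.
have g0 z : 0 <= g z by exact: powR_ge0.
have cg z : normc z <= 1 -> {for z, continuous g}.
  by move=> z1; apply: continuous_normc_powR => //; exact: cF.
have c20 : 0 < c / 2 by rewrite divr_gt0.
(* The error collects [3 e] times the mean of [|h|^p] from the pointwise bound, and [c / 2 * e] from
   replacing the mean of [g] by a Riemann sum. *)
suff key r0 e : 0 < r0 < 1 -> 0 < e -> c / 2 * hmean p F r0 <= 2 * SW + e * (3 * Sh + c / 2).
  have k0 : 0 < 3 * Sh + c / 2 by lra.
  rewrite mulrC -ler_pdivlMr //; apply: hsup_le => // r0 r01.
  rewrite ler_pdivlMr // mulrC; apply/ler_addgt0Pr => e e0.
  apply: le_trans (key r0 (e / (3 * Sh + c / 2)) r01 (divr_gt0 e0 k0)) _.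
  by rewrite divfK // gt_eqF.
move=> /andP[r00 r01] e0.
have [K K0 KP] := quadratic_modulus e0 g0 cg.
have K1 : 0 < 2 * (K + 1) by lra.
(* Chosen so that [K (1 - r^2) <= 2 K (1 - r) <= e]; [r >= r0] serves to compare the means of
   [|F|^p]. *)
pose r := Num.max r0 (1 - e / (2 * (K + 1))).
have r0r : r0 <= r by rewrite le_max lexx.
have rK : 1 - e / (2 * (K + 1)) <= r by rewrite le_max lexx orbT.
have eK : 0 < e / (2 * (K + 1)) by rewrite divr_gt0.
have r1 : r < 1 by rewrite gt_max r01 /=; lra.
have rpos : 0 < r by exact: lt_le_trans r0r.
have Kr : K * (1 - r ^+ 2) <= e.
  have A : 1 - r ^+ 2 <= 2 * (1 - r) by have := sqr_ge0 (1 - r); rewrite sqrrB mulr2n; lra.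
  have B : K * (1 - r ^+ 2) <= K * (2 * (1 - r)) by rewrite ler_wpM2l.
  have D : (K + 1) * (2 * (1 - r)) <= e.
    have -> : e = (K + 1) * (2 * (e / (2 * (K + 1)))) by field; lra.
    by rewrite ler_pM2l ?ler_pM2l //; lra.
  lra.
have [n1 n1P] := riemann_sum_circle e0 cg.
have [|n2 n2P] := @poisson_sum_le r; first by rewrite rpos r1.
pose n := (maxn n1 n2).+1.
have nn1 : (n1 <= n)%N by rewrite leqW // leq_maxl.
have nn2 : (n2 <= n)%N by rewrite leqW // leq_maxr.
have N0 : 0 <= n%:R^-1 :> R by rewrite invr_ge0.
pose th (j : nat) : R := 2 * pi * (j%:R / n%:R).
pose w j : C := r%:C * cis (th j).
have nw j : normc (w j) = r by rewrite normc_polar // ltW.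
have w1 j : normc (w j) < 1 by rewrite nw.
have iWl j : in_Hp p (wcomp h psi (test_fn p (w j))) by apply: iW; exact: in_Hp_test_fn.
(* Halving [c] makes the bound strict below the supremum, so it is reached at some radius below
   1. *)
have [s /andP[s0 s1] sP] : exists2 s, 0 < s < 1 & forall j, (j < n)%N ->
    c / 2 <= hmean p (wcomp h psi (test_fn p (w j))) s.
  apply: (@common_radius (fun j s => c / 2 <= hmean p (wcomp h psi (test_fn p (w j))) s)).
    move=> j s s' s0 ss' s'1 cs; apply: le_trans cs _.
    exact: (hmean_mono p0 (ltW s0) ss' s'1 (iWl j).1).
  move=> j; have [|s s01 cs] := @lt_hsup_hmean R p _ (c / 2) p0 (iWl j).
    by have := cW _ (w1 j); lra.
  by exists s => //; exact: ltW.
have s01 : 0 <= s < 1 by rewrite s1 ltW.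
have s01' : 0 < s < 1 by rewrite s0.
pose a j t := normc (wcomp h psi (test_fn p (w j)) (s%:C * cis t)) `^ p.
have ca j : continuous (a j) := continuous_hmean p0 s01 (iWl j).1.
have chs := continuous_hmean p0 s01 hh.
have cWs := continuous_hmean p0 s01 hWF.
have cga (j : 'I_n) : continuous (fun t => g (w j) * a j t).
  by move=> t; apply: cvgM; [exact: cvg_cst|exact: ca].
have step1 : c / 2 * riemann_sum (fun t => g (r%:C * cis t)) n <=
    mean (fun t => n%:R^-1 * \sum_(j < n) g (w j) * a j t).
  rewrite meanZ; last exact: continuous_bigsum.
  rewrite mean_sum // /riemann_sum mulrCA ler_wpM2l // mulr_sumr.
  apply: ler_sum => j _; rewrite meanZ // mulrC ler_wpM2l ?g0 //.
  exact: sP.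
have pointwise t : n%:R^-1 * \sum_(j < n) g (w j) * a j t <=
    2 * normc (wcomp h psi F (s%:C * cis t)) `^ p + 3 * e * normc (h (s%:C * cis t)) `^ p.
  set zeta := s%:C * cis t; set z := psi zeta.
  have zeta1 : normc zeta < 1 by rewrite normc_polar // ltW.
  have z1 : normc z < 1 by exact: dpsi.
  set H := normc (h zeta) `^ p; have H0 : 0 <= H by exact: powR_ge0.
  have aE j : a j t = H * poisson (w j) z.
    by rewrite /a /wcomp ComplexField.Normc.normcM powRM ?normc_ge0 // normc_test_fn.
  have -> : normc (wcomp h psi F zeta) `^ p = H * g z.
    by rewrite /wcomp ComplexField.Normc.normcM powRM ?normc_ge0.
  have P0 j : 0 <= poisson (w j) z by exact: poisson_ge0.
  (* The Poisson average being at most 2, [g z + e] contributes [2 g z + 2 e], and the quadratic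
     term contributes [K (1 - r^2) <= e]. *)
  have bound : n%:R^-1 * \sum_(j < n) g (w j) * poisson (w j) z <= 2 * g z + 3 * e.
    have termb (j : 'I_n) : g (w j) * poisson (w j) z <=
        (g z + e) * poisson (w j) z + K * (1 - r ^+ 2).
      have A := ler_wpM2r (P0 j) (KP (w j) z (ltW (w1 j)) (ltW z1)).
      apply: le_trans A _; rewrite mulrDl lerD2l -mulrA ler_wpM2l //.
      by have := dist_poisson_le (w1 j) z1; rewrite nw.
    have B := n2P n nn2 z z1; rewrite /riemann_sum -/w in B.
    apply: (@le_trans _ _ (n%:R^-1 * \sum_(j < n) ((g z + e) * poisson (w j) z + K * (1 - r ^+ 2)))).
      by rewrite ler_wpM2l // ler_sum.
    rewrite big_split /= -mulr_sumr sumr_const card_ord mulrDr mulrCA.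
    have -> : n%:R^-1 * (K * (1 - r ^+ 2) *+ n) = K * (1 - r ^+ 2).
      by rewrite -[K * (1 - r ^+ 2) *+ n]mulr_natl mulKf // pnatr_eq0.
    have gz0 : 0 <= g z + e by have := g0 z; lra.
    have := ler_wpM2l gz0 B; lra.
  have -> : n%:R^-1 * \sum_(j < n) g (w j) * a j t =
      H * (n%:R^-1 * \sum_(j < n) g (w j) * poisson (w j) z).
    rewrite mulrCA; congr (_ * _); rewrite mulr_sumr; apply: eq_bigr => j _.
    by rewrite aE mulrCA.
  have := ler_wpM2l H0 bound; lra.
have step2 : mean (fun t => n%:R^-1 * \sum_(j < n) g (w j) * a j t) <=
    2 * hmean p (wcomp h psi F) s + 3 * e * hmean p h s.
  rewrite /hmean -meanZD //; apply: le_mean => //.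
    by move=> t; apply: cvgM; [exact: cvg_cst|apply: continuous_bigsum; exact: cga].
  exact: continuousZD.
have A1 := hmean_le_hsup p0 s01' iWF; rewrite -/SW in A1.
have A2 := hmean_le_hsup p0 s01' ih; rewrite -/Sh in A2.
have A3 := hmean_mono p0 (ltW r00) r0r r1 hF.
have r1' : normc (r%:C : C) <= 1 by rewrite normc_real ger0_norm ltW.
have A4 := n1P n nn1 r%:C r1'.
have A5 : c / 2 * hmean p F r0 <= c / 2 * (riemann_sum (fun t => g (r%:C * cis t)) n + e).
  have {}A4 : `|riemann_sum (fun t => g (r%:C * cis t)) n - hmean p F r| <= e by exact: A4.
  rewrite ler_pM2l //; apply: le_trans A3 _.
  move: A4; clear; move: (hmean p F r) (riemann_sum _ n) => x y.
  by rewrite ler_norml; lra.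
have A6 := ler_wpM2l (ltW e0) A2.
move: A1 A5 A6 step1 step2; clear.
move: (hmean p F r0) (hmean p h s) (hmean p _ s) => x1 x2 x3.
move: (riemann_sum _ n) (mean _) => x4 x5; lra.
Qed.

End LowerBound.

(** * Passage to the whole of [H^p] and the equivalence *)

Lemma powR_normcD_le (R : realType) (p : R) (a b : R[i]) : 0 <= p ->
  normc (a + b) `^ p <= 2 `^ p * (normc a `^ p + normc b `^ p).
Proof.
move=> p0; have a0 := normc_ge0 a; have b0 := normc_ge0 b.
pose m := Num.max (normc a) (normc b).
have am : normc a <= m by rewrite le_max lexx.
have bm : normc b <= m by rewrite le_max lexx orbT.
have m0 : 0 <= m by exact: le_trans am.
apply: (@le_trans _ _ ((2 * m) `^ p)).
  apply: ge0_ler_powR; rewrite ?nnegrE ?normc_ge0 //; first by rewrite mulr_ge0.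
  by have := normcD a b; lra.
rewrite powRM // ler_pM2l ?powR_gt0 // /m /Num.max.
by case: ifP => _; [rewrite lerDr|rewrite lerDl]; exact: powR_ge0.
Qed.

(** The dilate [F_d] is continuous on the closed disc, so [hsup_wcomp_ge] applies to it. On the
    right, [W F_d = W F + W (F_d - F)] and boundedness makes the last term small; on the left, the
    mean of [F] at [r] is that of [F_d] at [r / d]. *)
Lemma hsup_wcomp_ge_Hp (R : realType) (p c M : R) (h psi F : R[i]^o -> R[i]^o) :
  1 <= p -> 0 < c -> 0 <= M ->
  in_Hp p h -> holomorphic_on_disc psi -> (forall z, in_disc z -> in_disc (psi z)) ->
  (forall f, in_Hp p f -> in_Hp p (wcomp h psi f)) ->
  (forall f, in_Hp p f -> hsup p (wcomp h psi f) <= M * hsup p f) ->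
  (forall w, in_disc w -> c <= hsup p (wcomp h psi (test_fn p w))) ->
  in_Hp p F -> c / 2 * hsup p F <= 2 * 2 `^ p * hsup p (wcomp h psi F).
Proof.
move=> p1 c0 M0 ih hpsi dpsi iW bW cW iF; have p0 : 0 < p by lra.
have [hF _] := iF; have iWF := iW F iF.
have hWF : holomorphic_on_disc (wcomp h psi F) := iWF.1.
set SW := hsup p (wcomp h psi F).
have T0 : 0 < 2 `^ p :> R by rewrite powR_gt0.
have c20 : 0 < c / 2 by rewrite divr_gt0.
have k0 : 0 < 2 * 2 `^ p * (M + 1) by rewrite !mulr_gt0 //; lra.
suff key r e : 0 < r < 1 -> 0 < e ->
    c / 2 * hmean p F r <= 2 * 2 `^ p * SW + 2 * 2 `^ p * (M + 1) * e.
  rewrite mulrC -ler_pdivlMr //; apply: hsup_le; [exact: p0|exact: hF|].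
  move=> r r01; rewrite ler_pdivlMr // mulrC; apply/ler_addgt0Pr => e e0.
  apply: le_trans (key r _ r01 (divr_gt0 e0 k0)) _.
  by rewrite [_ * (e / _)]mulrC divfK // gt_eqF.
move=> /andP[r0 r1] e0.
have [d0 /andP[d00 d01] d0P] := dilate_cvg p1 iF e0.
(* Above [d0] for the approximation, and above [r] so that [r / d < 1]. *)
pose d := (Num.max d0 r + 1) / 2.
have m1 : Num.max d0 r < 1 by rewrite gt_max d01.
have dm : Num.max d0 r < d by rewrite /d; lra.
have d1 : d < 1 by rewrite /d; lra.
have d0d : d0 < d by apply: le_lt_trans dm; rewrite le_max lexx.
have rd : r < d by apply: le_lt_trans dm; rewrite le_max lexx orbT.
have dpos : 0 < d by lra.
have d01c : 0 < d <= 1 by rewrite dpos ltW.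
have d01w : 0 <= d <= 1 by rewrite !ltW.
have iD := in_Hp_dilate p0 d01c iF.
have hD := holomorphic_dilate d01w hF.
have hB := holomorphic_sub hD hF.
have bB := d0P d d0d d1.
have iB := in_Hp_bounded p0 hB bB.
have cD z : normc z <= 1 -> {for z, continuous (dilate d F)}.
  move=> z1; apply: derivableC_continuous; apply: derivable_dilate; apply: hF.
  rewrite /in_disc normc_scale ?(ltW dpos) //; apply: le_lt_trans d1.
  by rewrite ler_piMr // ltW.
have main := hsup_wcomp_ge p0 c0 ih hpsi dpsi iW cW iD cD.
have E1 : hmean p F r <= hsup p (dilate d F).
  have -> : hmean p F r = hmean p (dilate d F) (r / d).
    by rewrite hmean_dilate mulrC divfK // gt_eqF.
  by apply: hmean_le_hsup => //; rewrite divr_gt0 // ltr_pdivrMr // mul1r.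
have E2 : hsup p (wcomp h psi (fun z => dilate d F z - F z)) <= M * e.
  apply: le_trans (bW _ iB) _; apply: ler_wpM2l; first exact: M0.
  exact: (hsup_le p0 hB bB).
have iWB := iW _ iB.
have E3 : hsup p (wcomp h psi (dilate d F)) <= 2 `^ p * (SW + M * e).
  apply: hsup_le; [exact: p0|exact: (iW _ iD).1|] => s s01.
  have s01' : 0 <= s < 1 by case/andP: s01 => /ltW ->.
  have c1 := continuous_hmean p0 s01' hWF.
  have c2 := continuous_hmean p0 s01' iWB.1.
  apply: (@le_trans _ _ (2 `^ p * hmean p (wcomp h psi F) s +
      2 `^ p * hmean p (wcomp h psi (fun z => dilate d F z - F z)) s)).
    rewrite /hmean -(meanZD _ _ c1 c2); apply: le_mean.
    - exact: (continuous_hmean p0 s01' (iW _ iD).1).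
    - exact: (@continuousZD _ _ _ _ _ c1 c2).
    - move=> t; rewrite -mulrDr; set z := s%:C * cis t.
      have -> : wcomp h psi (dilate d F) z =
          wcomp h psi F z + wcomp h psi (fun z => dilate d F z - F z) z.
        by rewrite /wcomp -mulrDr addrC subrK.
      exact: powR_normcD_le (ltW p0).
  rewrite -mulrDr ler_pM2l //; apply: lerD; first exact: (hmean_le_hsup p0 s01 iWF).
  apply: le_trans E2; exact: (hmean_le_hsup p0 s01 iWB).
have F1 := ler_wpM2l (ltW c20) E1.
have F2 : 0 <= 2 `^ p * e by rewrite mulr_ge0 // ltW.
move: main E3 F1 F2; clear.
move: (hmean p F r) (hsup p (dilate d F)) (hsup p (wcomp h psi (dilate d F))) => x1 x2 x3.
move: SW => S; lra.
Qed.

Theorem theorem2p3 (R : realType) (p : R) (h psi : R[i] -> R[i]) :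
  1 <= p ->
  in_Hp p h ->
  holomorphic_on_disc psi ->
  (forall z, in_disc z -> in_disc (psi z)) ->
  (forall f, in_Hp p f -> in_Hp p (wcomp h psi f)) ->
  (exists M : R, forall f, in_Hp p f ->
      hp_norm p (wcomp h psi f) <= M * hp_norm p f) ->
  (exists2 delta : R, 0 < delta & forall f, in_Hp p f ->
      delta * hp_norm p f <= hp_norm p (wcomp h psi f))
  <->
  (exists2 C : R, 0 < C & forall w, in_disc w ->
      C <= hp_norm p (wcomp h psi (test_fn p w))).
Proof.
move=> p1 ih hpsi dpsi iW [M bW]; have p0 : 0 < p by lra.
have pV0 : 0 < p^-1 by rewrite invr_gt0.
have powK (x : R) : 0 <= x -> (x `^ p^-1) `^ p = x.
  by move=> x0; rewrite -powRrM mulVf ?gt_eqF // powRr1.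
split=> [[delta delta0 dP]|[c c0 cP]].
  (* The factor is the lower bound for the norms of the test functions given by
     [hsup_test_fn_ge]. *)
  exists (delta * (2^-1) `^ p^-1); first by rewrite mulr_gt0 // powR_gt0 // invr_gt0.
  move=> w w1; apply: le_trans (dP _ (in_Hp_test_fn p0 w1)).
  rewrite ler_pM2l // hp_normE; apply: ge0_ler_powR.
  - exact: ltW.
  - by rewrite nnegrE invr_ge0.
  - by rewrite nnegrE; apply: (hsup_ge0 p0); exact: holomorphic_test_fn.
  - exact: hsup_test_fn_ge.
have cp0 : 0 < c `^ p by rewrite powR_gt0.
have T0 : 0 < 2 `^ p :> R by rewrite powR_gt0.
have powle (x y : R) : 0 <= x -> x <= y -> x `^ p <= y `^ p.
  by move=> x0 xy; apply: ge0_ler_powR; rewrite ?nnegrE // ?(ltW p0) // (le_trans x0).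
have cS w : in_disc w -> c `^ p <= hsup p (wcomp h psi (test_fn p w)).
  move=> w1; have iw := iW _ (in_Hp_test_fn p0 w1).
  by rewrite -[leRHS]powK ?(hsup_ge0 p0 iw.1) // powle ?(ltW c0) // cP.
(* The sign of [M] is unknown, so its absolute value is the one raised to the power [p]. *)
have bS f : in_Hp p f -> hsup p (wcomp h psi f) <= `|M| `^ p * hsup p f.
  move=> jf; have Sf0 := hsup_ge0 p0 jf.1; have SW0 := hsup_ge0 p0 (iW _ jf).1.
  rewrite -[leLHS](powK _ SW0) -[in leRHS](powK _ Sf0) -powRM ?powR_ge0 //.
  apply: powle; first exact: powR_ge0.
  by apply: le_trans (bW f jf) _; rewrite ler_wpM2r ?powR_ge0 // ler_norm.
(* Solves [c^p / 2 * S f <= 2 * 2^p * S (W f)] for [S (W f)]; the [p]-th root of [k] is the lower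
   bound for the norms. *)
pose k := c `^ p / 2 / (2 * 2 `^ p).
have k0 : 0 < k by rewrite !divr_gt0 // mulr_gt0.
exists (k `^ p^-1); first by rewrite powR_gt0.
move=> f jf; rewrite !hp_normE.
have Sf0 := hsup_ge0 p0 jf.1; have SW0 := hsup_ge0 p0 (iW _ jf).1.
rewrite -powRM ?(ltW k0) //; apply: ge0_ler_powR.
- exact: ltW.
- by rewrite nnegrE; exact: mulr_ge0 (ltW k0) Sf0.
- by rewrite nnegrE.
have := hsup_wcomp_ge_Hp p1 cp0 (powR_ge0 `|M| p) ih hpsi dpsi iW bS cS jf.
have D0 : 0 < 2 * 2 `^ p :> R by rewrite mulr_gt0.
move: (hsup p f) (hsup p _) => x y xy.
by rewrite /k mulrAC (ler_pdivrMr _ _ D0) [leRHS]mulrC.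
Qed.
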